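(* Let $H$ be a semisimple Hopf algebra over an algebraically closed field $K$ of characteristic zero. Suppose that $V$ is a finite-dimensional $H$-module with character $\chi$ and that $m$ is a natural number. Then the $m$-th Frobenius-Schur indicator of $\chi$ is $$\nu_m(\chi)=\frac{1}{\dim(H)}\operatorname{tr}\bigl(t^m|_{V\otimes H^*}\bigr).$$
   Context: A semisimple Hopf algebra is finite-dimensional, and contains a unique two-sided integral $\Lambda$ with $\varepsilon(\Lambda)=1$, where $\varepsilon$ is the counit. For $h\in H$ and $m\ge 1$, put $h^{[m]} := h_{(1)}h_{(2)}\cdots h_{(m)}$ (Sweedler notation for the iterated coproduct). The $m$-th Frobenius-Schur indicator of a character $\chi$ of $H$ is $\nu_m(\chi):=\chi(\Lambda^{[m]})$. Let $b_1,\ldots,b_n$ be a basis of $H$ with dual basis $b_1^*,\ldots,b_n^*$ of $H^*$; the canonical tensor is $t:=\sum_{i=1}^n b_i\otimes b_i^*\in H\otimes H^*$, which does not depend on the choice of basis. Here $H^*$ is the dual Hopf algebra (product given by convolution), and the algebra $H\otimes H^*$ acts on $V\otimes H^*$ so that $H$ acts on $V$ by the module action and $H^*$ acts on $H^*$ by left multiplication; $t^m|_{V\otimes H^*}$ is the endomorphism given by the action of $t^m$. Modules are left modules. *)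

(* Defs.v *)
From HB Require Import structures.
From mathcomp Require Import all_boot all_order all_algebra all_field.
From Stdlib Require Import ClassicalEpsilon.

Set Implicit Arguments.
Unset Strict Implicit.
Unset Printing Implicit Defensive.

Import GRing.Theory.
Local Open Scope ring_scope.

Section TensorDef.
Import VectorInternalTheory.

(* U (x) V is modelled by matrices indexed by the canonical coordinates of U
   and V, with u (x) v the rank-one matrix of products of coordinates.
   [tliftE] and [tensor_ext] below establish the universal property, and
   everything else only goes through it. *)
Definition tensor (K : fieldType) (U V : vectType K) : Type :=
  'M[K]_(dim U, dim V).

HB.instance Definition _ (K : fieldType) (U V : vectType K) :=
  Vector.copy (tensor U V) 'M[K]_(dim U, dim V).

Definition tens (K : fieldType) (U V : vectType K) (u : U) (v : V) :
  tensor U V := \matrix_(i, j) (v2r u 0 i * v2r v 0 j).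

Definition tlift_fun (K : fieldType) (U V W : vectType K) (B : U -> V -> W)
  (s : tensor U V) : W :=
  \sum_i \sum_j s i j *: B (r2v (delta_mx 0 i)) (r2v (delta_mx 0 j)).

End TensorDef.

Notation "u *t v" := (tens u v) (at level 40, left associativity) : ring_scope.

Section TensorTheory.
Import VectorInternalTheory.
Variable K : fieldType.

Section Lift.
Variables U V W : vectType K.

Fact tlift_is_linear (B : U -> V -> W) : linear (tlift_fun B).
Proof.
move=> a s t; rewrite /tlift_fun scaler_sumr -big_split; apply: eq_bigr => i _.
rewrite scaler_sumr -big_split; apply: eq_bigr => j _ /=.
by rewrite !mxE scalerDl scalerA.
Qed.
HB.instance Definition _ (B : U -> V -> W) :=
  GRing.isSemilinear.Build K (tensor U V) W _ (tlift_fun B)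
    (GRing.semilinear_linear (tlift_is_linear B)).

(* The linear map on U (x) V induced by a bilinear map B. *)
Definition tlift (B : U -> V -> W) : 'Hom(tensor U V, W) :=
  linfun (tlift_fun B).

Fact tens_linearl (v : V) : linear (fun u : U => u *t v).
Proof.
by move=> a x y; apply/matrixP=> i j; rewrite !mxE linearP !mxE mulrDl mulrA.
Qed.

Fact tens_linearr (u : U) : linear (fun v : V => u *t v).
Proof.
move=> a x y; apply/matrixP=> i j; rewrite !mxE linearP !mxE mulrDr.
by rewrite mulrCA.
Qed.

Lemma r2v_sum (T : vectType K) (u : T) :
  u = \sum_i v2r u 0 i *: r2v (delta_mx 0 i).
Proof.
rewrite -[LHS]v2rK {1}(row_sum_delta (v2r u)) linear_sum.
by apply: eq_bigr => i _; rewrite linearZ.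
Qed.

Lemma linear_fun_sum (T T' : vectType K) (f : T -> T') (u : T) :
  linear f -> f u = \sum_i v2r u 0 i *: f (r2v (delta_mx 0 i)).
Proof.
move=> lf.
pose F : {linear T -> T'} :=
  HB.pack f (GRing.isSemilinear.Build K T T' _ f (GRing.semilinear_linear lf)).
rewrite -[f]/(F : _ -> _) {1}(r2v_sum u) linear_sum.
by apply: eq_bigr => i _; rewrite linearZ.
Qed.

Lemma tliftE (B : U -> V -> W) :
    (forall v, linear (fun u => B u v)) -> (forall u, linear (B u)) ->
  forall u v, tlift B (u *t v) = B u v.
Proof.
move=> Bl Br u v; rewrite lfunE /= /tlift_fun (linear_fun_sum u (Bl v)).
apply: eq_bigr => i _; rewrite (linear_fun_sum v (Br _)) scaler_sumr.
by apply: eq_bigr => j _; rewrite mxE scalerA.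
Qed.

Lemma tensor_sumE (s : tensor U V) :
  s = \sum_i \sum_j s i j *: (r2v (delta_mx 0 i) *t r2v (delta_mx 0 j)).
Proof.
rewrite {1}[s]matrix_sum_delta; apply: eq_bigr => i _; apply: eq_bigr => j _.
congr (_ *: _); apply/matrixP => k l; rewrite !mxE !r2vK !mxE !eqxx /=.
by rewrite -natrM mulnb.
Qed.

Lemma tensor_ext (f g : 'Hom(tensor U V, W)) :
  (forall u v, f (u *t v) = g (u *t v)) -> f = g.
Proof.
move=> fg; apply/lfunP => s.
rewrite [s]tensor_sumE !linear_sum; apply: eq_bigr => i _.
by rewrite !linear_sum; apply: eq_bigr => j _; rewrite !linearZ /= fg.
Qed.

Lemma linear_tliftr (T : vectType K) (B : T -> U -> V -> W) (s : tensor U V) :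
  (forall u v, linear (fun t => B t u v)) -> linear (fun t => tlift (B t) s).
Proof.
move=> Bl a x y; rewrite !lfunE /= /tlift_fun scaler_sumr -big_split.
apply: eq_bigr => i _; rewrite scaler_sumr -big_split.
by apply: eq_bigr => j _; rewrite /= Bl scalerDr scalerA mulrC -scalerA.
Qed.

End Lift.

Lemma tensDl (U V : vectType K) (u u' : U) (v : V) :
  (u + u') *t v = u *t v + u' *t v.
Proof. by have:= tens_linearl v 1 u u'; rewrite !scale1r. Qed.

Lemma tensDr (U V : vectType K) (u : U) (v v' : V) :
  u *t (v + v') = u *t v + u *t v'.
Proof. by have:= tens_linearr u 1 v v'; rewrite !scale1r. Qed.

Lemma tens0l (U V : vectType K) (v : V) : (0 : U) *t v = 0.
Proof. by apply/(addrI (0 *t v)); rewrite -tensDl !addr0. Qed.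

Lemma tens0r (U V : vectType K) (u : U) : u *t (0 : V) = 0.
Proof. by apply/(addrI (u *t 0)); rewrite -tensDr !addr0. Qed.

Lemma tensZl (U V : vectType K) (a : K) (u : U) (v : V) :
  (a *: u) *t v = a *: (u *t v).
Proof. by have:= tens_linearl v a u 0; rewrite tens0l !addr0. Qed.

Lemma tensZr (U V : vectType K) (a : K) (u : U) (v : V) :
  u *t (a *: v) = a *: (u *t v).
Proof. by have:= tens_linearr u a v 0; rewrite tens0r !addr0. Qed.

Lemma tens_suml (U V : vectType K) (I : finType) (F : I -> U) (v : V) :
  (\sum_i F i) *t v = \sum_i (F i *t v).
Proof.
by apply: (big_morph (fun u => u *t v)) => [x y|]; rewrite ?tensDl ?tens0l.
Qed.

Lemma tens_sumr (U V : vectType K) (I : finType) (u : U) (F : I -> V) :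
  u *t (\sum_i F i) = \sum_i (u *t F i).
Proof. by apply: (big_morph (tens u)) => [x y|]; rewrite ?tensDr ?tens0r. Qed.

Lemma tensor_ind (U V : vectType K) (P : tensor U V -> Prop) :
  (forall u v, P (u *t v)) -> (forall s t, P s -> P t -> P (s + t)) ->
  forall s, P s.
Proof.
move=> Pt PD s; have P0 : P 0 by rewrite -(tens0l U (0 : V)).
rewrite [s]tensor_sumE; apply: big_ind => // i _; apply: big_ind => // j _.
by rewrite -tensZl.
Qed.

Definition tmap (U V U' V' : vectType K) (f : 'Hom(U, U')) (g : 'Hom(V, V')) :
  'Hom(tensor U V, tensor U' V') := tlift (fun u v => f u *t g v).

Definition tassoc (U V W : vectType K) :
  'Hom(tensor (tensor U V) W, tensor U (tensor V W)) :=
  tlift (fun s w => tlift (fun u v => u *t (v *t w)) s).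

Lemma tmapE (U V U' V' : vectType K) (f : 'Hom(U, U')) (g : 'Hom(V, V')) u v :
  tmap f g (u *t v) = f u *t g v.
Proof.
rewrite /tmap tliftE // => [{}v|{}u] a x y.
- by rewrite linearP tensDl tensZl.
- by rewrite linearP tensDr tensZr.
Qed.

Lemma tassocE (U V W : vectType K) (u : U) (v : V) (w : W) :
  tassoc U V W ((u *t v) *t w) = u *t (v *t w).
Proof.
rewrite /tassoc tliftE ?tliftE // => [{}v|{}u|{}w|s] c x y.
- by rewrite tensDl tensZl.
- by rewrite tensDl tensZl tensDr tensZr.
- by rewrite linearP.
- by move: c x y; apply: linear_tliftr => u' v' c x y;
    rewrite !tensDr !tensZr.
Qed.

(* f (x) g as a linear form on U (x) V, under K (x) K = K. *)
Definition tpair (U V : vectType K) (f : 'Hom(U, K^o)) (g : 'Hom(V, K^o)) :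
  'Hom(tensor U V, K^o) := tlift (fun u v => f u * g v : K^o).

Lemma tpairE (U V : vectType K) (f : 'Hom(U, K^o)) (g : 'Hom(V, K^o)) u v :
  tpair f g (u *t v) = f u * g v.
Proof.
rewrite /tpair tliftE // => [{}v|{}u] a x y; rewrite linearP.
- by rewrite mulrDl -scalerAl.
- by rewrite mulrDr -scalerAr.
Qed.

End TensorTheory.

Section TensorAlgebra.
Import VectorInternalTheory.
Variables (K : fieldType) (A B : falgType K).
Implicit Types (a : A) (b : B) (s t r : tensor A B).

Definition tensor_one : tensor A B := 1 *t 1.

Definition tensor_mul s t : tensor A B :=
  tlift (fun a b => tlift (fun a' b' => (a * a') *t (b * b')) t) s.

Lemma tensor_mulE a b a' b' :
  tensor_mul (a *t b) (a' *t b') = (a * a') *t (b * b').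
Proof.
rewrite /tensor_mul tliftE ?tliftE //.
- by move=> {}b' c x y; rewrite mulrDr -scalerAr tensDl tensZl.
- by move=> {}a' c x y; rewrite mulrDr -scalerAr tensDr tensZr.
- move=> {}b; apply: linear_tliftr => {}a' {}b' c x y.
  by rewrite mulrDl -scalerAl tensDl tensZl.
- move=> {}a; apply: linear_tliftr => {}a' {}b' c x y.
  by rewrite mulrDl -scalerAl tensDr tensZr.
Qed.

Fact tensor_mul_linearl t : linear (tensor_mul^~ t).
Proof. by move=> c x y; rewrite /tensor_mul linearP. Qed.

Fact tensor_mul_linearr s : linear (tensor_mul s).
Proof. by apply: linear_tliftr => a b c x y; rewrite linearP. Qed.

Fact tensor_mulDl : left_distributive tensor_mul +%R.
Proof.
by move=> x y z; have:= tensor_mul_linearl z 1 x y; rewrite !scale1r.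
Qed.

Fact tensor_mulDr : right_distributive tensor_mul +%R.
Proof.
by move=> x y z; have:= tensor_mul_linearr x 1 y z; rewrite !scale1r.
Qed.

Fact tensor_mulA : associative tensor_mul.
Proof.
move=> x y z; elim/tensor_ind: x => [a b|? ? IH1 IH2]; last first.
  by rewrite !tensor_mulDl IH1 IH2.
elim/tensor_ind: y => [a' b'|? ? IH1 IH2]; last first.
  by rewrite !(tensor_mulDl, tensor_mulDr) IH1 IH2.
elim/tensor_ind: z => [a'' b''|? ? IH1 IH2]; last first.
  by rewrite !tensor_mulDr IH1 IH2.
by rewrite !tensor_mulE !mulrA.
Qed.

Fact tensor_mul1l : left_id tensor_one tensor_mul.
Proof.
elim/tensor_ind => [a b|? ? IH1 IH2]; last by rewrite tensor_mulDr IH1 IH2.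
by rewrite tensor_mulE !mul1r.
Qed.

Fact tensor_mul1r : right_id tensor_one tensor_mul.
Proof.
elim/tensor_ind => [a b|? ? IH1 IH2]; last by rewrite tensor_mulDl IH1 IH2.
by rewrite tensor_mulE !mulr1.
Qed.

Fact tensor_one_neq0 : tensor_one != 0.
Proof.
have nz (T : falgType K) : exists i, v2r (1 : T) 0 i != 0.
  apply/existsP; apply: contraR (oner_neq0 T); rewrite negb_exists.
  move=> /forallP z; apply/eqP/v2r_inj.
  by apply/rowP => i; rewrite [v2r 0]linear0 !mxE; apply/eqP; rewrite -[_ == _]negbK z.
have [i ni] := nz A; have [j nj] := nz B.
apply: contraTneq (mulf_neq0 ni nj) => /matrixP/(_ i j).
by rewrite !mxE => ->; rewrite eqxx.
Qed.

HB.instance Definition _ := GRing.Zmodule_isNzRing.Build (tensor A B)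
  tensor_mulA tensor_mul1l tensor_mul1r tensor_mulDl tensor_mulDr
  tensor_one_neq0.

Fact tensor_scaleAl (c : K) s t : c *: (s * t) = (c *: s) * t.
Proof. by rewrite /GRing.mul /= /tensor_mul linearZ. Qed.

HB.instance Definition _ :=
  GRing.Lmodule_isLalgebra.Build K (tensor A B) tensor_scaleAl.

Fact tensor_scaleAr (c : K) s t : c *: (s * t) = s * (c *: t).
Proof.
have:= tensor_mul_linearr s c t 0.
by rewrite -[tensor_mul s 0]/(s * 0) mulr0 !addr0.
Qed.

HB.instance Definition _ :=
  GRing.Lalgebra_isAlgebra.Build K (tensor A B) tensor_scaleAr.

HB.instance Definition _ := Algebra_isFalgebra.Build K (tensor A B).

Lemma tensM a b a' b' : (a *t b) * (a' *t b') = (a * a') *t (b * b').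
Proof. exact: tensor_mulE. Qed.

End TensorAlgebra.

Record fdmodule (K : fieldType) (A : falgType K) := FdModule {
  fdmodule_sort :> vectType K;
  mact : 'Hom(A, 'End(fdmodule_sort));
  mact1 : mact 1 = \1%VF;
  mactM : forall a b : A, mact (a * b) = (mact a \o mact b)%VF
}.

Section Modules.
Variables (K : fieldType) (A B : falgType K).

Fact regular_act1 : linfun (@amull K A) 1 = \1%VF.
Proof. by rewrite lfunE /= amull1. Qed.

Fact regular_actM (a b : A) :
  linfun (@amull K A) (a * b)
    = (linfun (@amull K A) a \o linfun (@amull K A) b)%VF.
Proof. by apply/lfunP => x; rewrite comp_lfunE !lfunE /= mulrA. Qed.

Definition regular_module : fdmodule A :=
  FdModule regular_act1 regular_actM.

Definition tensor_act (M : fdmodule A) (N : fdmodule B) :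
  'Hom(tensor A B, 'End(tensor M N)) :=
  tlift (fun a b => tmap (mact M a) (mact N b)).

Lemma tensor_actE (M : fdmodule A) (N : fdmodule B) a b (x : M) (y : N) :
  tensor_act M N (a *t b) (x *t y) = mact M a x *t mact N b y.
Proof.
rewrite /tensor_act tliftE ?tmapE // => [{}b|{}a] c s t;
  apply: tensor_ext => u v.
- by rewrite add_lfunE scale_lfunE !tmapE linearP add_lfunE scale_lfunE tensDl tensZl.
- by rewrite add_lfunE scale_lfunE !tmapE linearP add_lfunE scale_lfunE tensDr tensZr.
Qed.

Fact tensor_act1 (M : fdmodule A) (N : fdmodule B) :
  tensor_act M N 1 = \1%VF.
Proof.
by apply: tensor_ext => x y; rewrite tensor_actE !mact1 !lfunE.
Qed.

Fact tensor_actM (M : fdmodule A) (N : fdmodule B) (s t : tensor A B) :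
  tensor_act M N (s * t) = (tensor_act M N s \o tensor_act M N t)%VF.
Proof.
elim/tensor_ind: s => [a b|? ? IH1 IH2]; last first.
  by rewrite mulrDl !linearD /= IH1 IH2 comp_lfunDl.
elim/tensor_ind: t => [a' b'|? ? IH1 IH2]; last first.
  by rewrite mulrDr !linearD /= IH1 IH2 comp_lfunDr.
apply: tensor_ext => x y.
by rewrite comp_lfunE tensM !tensor_actE !mactM !comp_lfunE.
Qed.

(* M (x) N as a module over A (x) B, with (a *t b) (x *t y) = ax *t by. *)
Definition tensor_module (M : fdmodule A) (N : fdmodule B) :
  fdmodule (tensor A B) :=
  FdModule (tensor_act1 M N) (tensor_actM M N).

Definition submodule (M : fdmodule A) (U : {vspace M}) : Prop :=
  forall (a : A) (u : M), u \in U -> mact M a u \in U.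

Definition semisimple_module (M : fdmodule A) : Prop :=
  forall U : {vspace M}, submodule U ->
  exists2 W : {vspace M}, submodule W & (U + W = fullv)%VS /\ (U :&: W = 0)%VS.

Definition semisimple_algebra : Prop := semisimple_module regular_module.

Definition lftrace (V : vectType K) (f : 'End(V)) : K :=
  \tr (passmx.mxof (vbasis fullv) (vbasis fullv) f).

Lemma lftraceE (V : vectType K) (e : (\dim {:V}).-tuple V) (f : 'End(V)) :
  basis_of {:V} e -> lftrace f = \tr (passmx.mxof e e f).
Proof.
move=> eb; have cb := vbasisP {:V}; rewrite /lftrace.
set c := vbasis _ in cb *.
have -> : passmx.mxof e e f
    = passmx.mxof e c \1 *m passmx.mxof c c f *m passmx.mxof c e \1.
  by rewrite -!passmx.mxof_comp // comp_lfun1l comp_lfun1r.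
rewrite mxtrace_mulC mulmxA -passmx.mxof_comp // comp_lfun1l.
by rewrite passmx.mxof1 ?(basis_free cb) // mul1mx.
Qed.

Definition mchar (M : fdmodule A) (a : A) : K := lftrace (mact M a).

End Modules.

HB.mixin Record isHopfAlgebra (K : fieldType) H of Falgebra K H := {
  coprod : 'Hom(H, tensor H H);
  counit : 'Hom(H, K^o);
  antipode : 'End(H);
  coprodA : (tassoc H H H \o (tmap coprod \1) \o coprod
              = tmap \1 coprod \o coprod)%VF;
  counitl : forall h, tlift (fun a b : H => (counit a : K) *: b) (coprod h) = h;
  counitr : forall h, tlift (fun a b : H => (counit b : K) *: a) (coprod h) = h;
  coprod1 : coprod 1 = 1;
  coprodM : forall g h, coprod (g * h) = coprod g * coprod h;
  counit1 : counit 1 = 1;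
  counitM : forall g h, counit (g * h) = counit g * counit h;
  antipodel : forall h,
    tlift (fun a b : H => antipode a * b) (coprod h) = (counit h : K)%:A;
  antipoder : forall h,
    tlift (fun a b : H => a * antipode b) (coprod h) = (counit h : K)%:A
}.

#[short(type="hopfAlgType")]
HB.structure Definition HopfAlgebra (K : fieldType) :=
  { H of Falgebra K H & isHopfAlgebra K H }.

Section Dual.
Variables (K : fieldType) (H : hopfAlgType K).

(* The dual Hopf algebra of H, of which only the algebra structure, given by
   convolution, is recorded. *)
Definition hopf_dual (H : hopfAlgType K) : Type := 'Hom(H, K^o).

HB.instance Definition _ := Vector.copy (hopf_dual H) 'Hom(H, K^o).

Implicit Types f g : hopf_dual H.

Definition dual_one : hopf_dual H := counit.

Definition dual_mul f g : hopf_dual H := (tpair f g \o coprod)%VF.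

Fact dual_mulA : associative dual_mul.
Proof.
move=> f g h; rewrite /dual_mul.
have -> : tpair f (tpair g h \o coprod)%VF
    = (tpair f (tpair g h) \o tmap \1 coprod)%VF.
  by apply: tensor_ext => u v; rewrite comp_lfunE tmapE !tpairE comp_lfunE id_lfunE.
have -> : tpair (tpair f g \o coprod)%VF h
    = (tpair f (tpair g h) \o (tassoc H H H \o tmap coprod \1))%VF.
  apply: tensor_ext => u v.
  rewrite !comp_lfunE tmapE !tpairE comp_lfunE id_lfunE.
  elim/tensor_ind: (coprod u) => [a b|s t IHs IHt].
    by rewrite tassocE !tpairE mulrA.
  by rewrite tensDl !linearD /= mulrDl IHs IHt.
by rewrite -comp_lfunA -coprodA comp_lfunA.
Qed.

Fact dual_mul1l : left_id dual_one dual_mul.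
Proof.
move=> f; have E : tpair dual_one f
    = (f \o tlift (fun a b : H => (counit a : K) *: b))%VF.
  apply: tensor_ext => a b; rewrite comp_lfunE tpairE tliftE ?linearZ //.
  - by move=> {}b c x y; rewrite linearP scalerDl scalerA.
  - by move=> {}a c x y; rewrite scalerDr !scalerA mulrC.
by apply/lfunP => h; rewrite /dual_mul E !comp_lfunE counitl.
Qed.

Fact dual_mul1r : right_id dual_one dual_mul.
Proof.
move=> f; have E : tpair f dual_one
    = (f \o tlift (fun a b : H => (counit b : K) *: a))%VF.
  apply: tensor_ext => a b; rewrite comp_lfunE tpairE tliftE ?linearZ /= 1?mulrC //.
  - by move=> {}b c x y; rewrite scalerDr !scalerA mulrC.
  - by move=> {}a c x y; rewrite linearP scalerDl scalerA.
by apply/lfunP => h; rewrite /dual_mul E !comp_lfunE counitr.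
Qed.

Fact dual_mulDl : left_distributive dual_mul +%R.
Proof.
move=> f g h; rewrite /dual_mul -comp_lfunDl; congr (_ \o _)%VF.
by apply: tensor_ext => a b; rewrite add_lfunE !tpairE add_lfunE mulrDl.
Qed.

Fact dual_mulDr : right_distributive dual_mul +%R.
Proof.
move=> f g h; rewrite /dual_mul -comp_lfunDl; congr (_ \o _)%VF.
by apply: tensor_ext => a b; rewrite add_lfunE !tpairE add_lfunE mulrDr.
Qed.

Fact dual_one_neq0 : dual_one != 0.
Proof.
apply/eqP => /lfunP/(_ 1)/eqP.
by rewrite counit1 zero_lfunE oner_eq0.
Qed.

HB.instance Definition _ := GRing.Zmodule_isNzRing.Build (hopf_dual H)
  dual_mulA dual_mul1l dual_mul1r dual_mulDl dual_mulDr dual_one_neq0.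

Fact dual_scaleAl (c : K) f g : c *: (f * g) = (c *: f) * g.
Proof.
rewrite /GRing.mul /= /dual_mul comp_lfunZl; congr (_ \o _)%VF.
by apply: tensor_ext => a b; rewrite scale_lfunE !tpairE scale_lfunE scalerAl.
Qed.

HB.instance Definition _ :=
  GRing.Lmodule_isLalgebra.Build K (hopf_dual H) dual_scaleAl.

Fact dual_scaleAr (c : K) f g : c *: (f * g) = f * (c *: g).
Proof.
rewrite /GRing.mul /= /dual_mul comp_lfunZl; congr (_ \o _)%VF.
by apply: tensor_ext => a b; rewrite scale_lfunE !tpairE scale_lfunE scalerAr.
Qed.

HB.instance Definition _ :=
  GRing.Lalgebra_isAlgebra.Build K (hopf_dual H) dual_scaleAr.

HB.instance Definition _ := Algebra_isFalgebra.Build K (hopf_dual H).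

End Dual.

Section Indicator.
Variables (K : fieldType) (H : hopfAlgType K).

Definition two_sided_integral (L : H) : Prop :=
  forall h : H, h * L = (counit h : K) *: L /\ L * h = (counit h : K) *: L.

Definition normalized_integral (L : H) : Prop :=
  two_sided_integral L /\ counit L = 1.

Lemma normalized_integral_uniq (L L' : H) :
  normalized_integral L -> normalized_integral L' -> L = L'.
Proof.
move=> [iL eL] [iL' eL'].
by rewrite -[L]scale1r -eL' -(iL L').1 (iL' L).2 eL scale1r.
Qed.

Lemma normalized_integral_exists :
  semisimple_algebra H -> exists L : H, normalized_integral L.
Proof.
move=> ssH.
have act a x : mact (regular_module H) a x = a * x by rewrite !lfunE.
have subN : @submodule _ _ (regular_module H) (lker counit).
  by move=> a u; rewrite act !memv_ker counitM => /eqP ->; rewrite mulr0.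
have [W subW [NW NIW]] := ssH _ subN.
have WI x : x \in W -> counit x = 0 -> x = 0.
  move=> Wx x0; apply/eqP; rewrite -memv0 -NIW memv_cap Wx andbT memv_ker.
  by apply/eqP.
have /memv_addP[n Nn [w Ww nw]] : (1 : H) \in (lker counit + W)%VS.
  by rewrite NW memvf.
have ew : counit w = 1.
  rewrite -[RHS](@counit1 _ H) nw linearD /=.
  by move: Nn; rewrite memv_ker => /eqP ->; rewrite add0r.
have lw h : h * w = (counit h : K) *: w.
  apply/eqP; rewrite -subr_eq0; apply/eqP/WI.
    by rewrite rpredB ?rpredZ // -act; apply: subW.
  by rewrite linearB linearZ /= counitM ew subrr.
exists w; split=> // h; split=> //.
pose L := w * h - (counit h : K) *: w.
have lL x : x * L = (counit x : K) *: L.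
  by rewrite mulrBr mulrA -scalerAr lw -scalerAl scalerBr !scalerA mulrC.
have eL : counit L = 0.
  by rewrite linearB linearZ /= counitM ew mul1r [_ *: _]mulr1 subrr.
have subL : @submodule _ _ (regular_module H) <[L]>%VS.
  move=> a _ /vlineP[c ->]; rewrite act -scalerAr lL.
  by rewrite !rpredZ ?memv_line.
have [J subJ [LJ LIJ]] := ssH _ subL.
have /memv_addP[_ /vlineP[c ->] [f Jf cf]] : (1 : H) \in (<[L]> + J)%VS.
  by rewrite LJ memvf.
have : L \in (<[L]> :&: J)%VS.
  rewrite memv_cap memv_line /= -[X in X \in _]mulr1 cf mulrDr -scalerAr lL eL.
  by rewrite scale0r scaler0 add0r -act; apply: subJ.
by rewrite LIJ memv0 subr_eq0 => /eqP.
Qed.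

(* Arbitrary when H is not semisimple. *)
Definition hopf_integral : H := epsilon (inhabits 0) normalized_integral.

Lemma hopf_integralP : semisimple_algebra H -> normalized_integral hopf_integral.
Proof. by move=> /normalized_integral_exists; apply: epsilon_spec. Qed.

(* The (n + 1)-st tensor power. *)
Fixpoint tpow (U : vectType K) (n : nat) : vectType K :=
  if n is k.+1 then tensor U (tpow U k) else U.

(* h |-> h_(1) (x) ... (x) h_(n + 1) *)
Fixpoint iter_coprod (n : nat) : 'Hom(H, tpow H n) :=
  if n is k.+1 then (tmap \1 (iter_coprod k) \o coprod)%VF else \1%VF.

(* a_1 (x) ... (x) a_(n + 1) |-> a_1 ... a_(n + 1) *)
Fixpoint iter_prod (n : nat) : 'Hom(tpow H n, H) :=
  if n is k.+1 then tlift (fun (a : H) (s : tpow H k) => a * iter_prod k s)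
  else \1%VF.

(* h^[m]; the value at m = 0 is a convention. *)
Definition sweedler_pow (h : H) (m : nat) : H :=
  if m is k.+1 then iter_prod k (iter_coprod k h) else (counit h : K)%:A.

Definition fs_indicator (m : nat) (chi : H -> K) : K :=
  chi (sweedler_pow hopf_integral m).

Definition canonical_tensor_of (b : (\dim {:H}).-tuple H) :
  tensor H (hopf_dual H) :=
  \sum_(i < \dim {:H}) b`_i *t (linfun (coord b i : H -> K^o) : hopf_dual H).

Definition canonical_tensor : tensor H (hopf_dual H) :=
  canonical_tensor_of (vbasis {:H}).

Lemma canonical_tensorE (b : (\dim {:H}).-tuple H) :
  basis_of {:H} b -> canonical_tensor = canonical_tensor_of b.
Proof.
move=> bb; have cb := vbasisP {:H}; rewrite /canonical_tensor_of.
set c := vbasis _ in cb *.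
pose D (e : (\dim {:H}).-tuple H) i : hopf_dual H := linfun (coord e i : H -> K^o).
transitivity (\sum_(i < \dim {:H}) \sum_(j < \dim {:H})
    b`_j *t (coord b j c`_i *: D c i)).
  apply: eq_bigr => i _.
  rewrite {1}[c`_i](coord_basis bb) ?memvf // tens_suml.
  by apply: eq_bigr => j _; rewrite tensZl tensZr.
rewrite exchange_big; apply: eq_bigr => j _; rewrite -tens_sumr; congr (_ *t _).
apply/lfunP => x; rewrite sum_lfunE lfunE /=.
rewrite [x in RHS](coord_basis cb) ?memvf // linear_sum.
by apply: eq_bigr => i _; rewrite scale_lfunE lfunE linearZ /= [RHS]mulrC.
Qed.

End Indicator.

(* Main.v *)
(* Let x in H represent the regular character of the dual, p |-> tr (L_p | H^* ).
   Expanding t^m gives tr (t^m | V (x) H^* ) = chi (x^[m]), so the claim amounts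
   to x = (dim H) Lambda.

   In general p (x h) = tr (y |-> p ((y c)_(1)) (y c)_(2)) for
   c = S (h_(2)) h_(1); hence x is an integral, of counit dim H, as soon as
   S^2 = 1, while x^2 = (dim H) x always holds, x being cocommutative.  This
   reduces the claim to the theorem of Larson and Radford that S^2 = 1.

   For the latter, f (h) = tr (S^-2 L_h) is a right integral on H with
   f (Lambda) = 1.  It yields the distinguished grouplike
   g = Lambda_(1) f (Lambda_(2)), for which S^4 is conjugation by g, and
   U = S (Lambda_(2)) Lambda_(1), for which S^2 is conjugation by U and
   tr (L_a) = f (a U).  If f (1) = 0, then f vanishes on every power of g, hence
   on g p for every spectral idempotent p of g.  On a block e of H, U^2 is a
   scalar multiple zeta g of g, so that
   tr (L_(U p e)) = zeta^(1/2) beta_p D(e, p) with beta_p a square root of the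
   eigenvalue of g on p and D(e, p) an integer.  The vanishing of f (g p),
   together with tr (L_(U e)) = tr (L_e) > 0, then contradicts the positivity of
   the Gram matrix of D.  So f (1) <> 0, which forces g = 1 and S^4 = 1.  Finally
   tr (S^-2) = f (1) = f (x) = (dim H) tr (S^-2 L_(x / dim H)) is a nonzero
   integral multiple of dim H, and an involution with such a trace that fixes 1
   is the identity. *)

From HB Require Import structures.
Require Import Defs.
From mathcomp Require Import all_boot all_order all_algebra all_field.
From mathcomp Require Import zify.
From Stdlib Require Import Classical.

Set Implicit Arguments.
Unset Strict Implicit.
Unset Printing Implicit Defensive.

Import GRing.Theory.
Local Open Scope ring_scope.

(** * Linear maps as plain functions *)

Section Linear.
Variable K : fieldType.

(** Linearity is kept as a predicate on plain functions, so that the tactic [lin] can establish it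
    for arbitrary lambda-terms without bundling them. *)
Definition lin (U V : lmodType K) (f : U -> V) : Prop :=
  forall a u v, f (a *: u + v) = a *: f u + f v.

Section LinBasics.
Variables (U V : lmodType K) (f : U -> V).
Hypothesis fl : lin f.

Lemma linD u v : f (u + v) = f u + f v.
Proof. by have := fl 1 u v; rewrite !scale1r. Qed.

Lemma lin0 : f 0 = 0.
Proof. by apply: (addrI (f 0)); rewrite -linD !addr0. Qed.

Lemma linZ a u : f (a *: u) = a *: f u.
Proof. by have := fl a u 0; rewrite lin0 !addr0. Qed.

Lemma linB u v : f (u - v) = f u - f v.
Proof. by rewrite addrC -scaleN1r fl scaleN1r addrC. Qed.

Lemma lin_sumE (I : finType) (F : I -> U) : f (\sum_i F i) = \sum_i f (F i).
Proof. by apply: (big_morph f); [apply: linD | apply: lin0]. Qed.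
End LinBasics.

Section LinClosure.
Variables U V W : lmodType K.

Lemma lin_id : lin (fun u : U => u).
Proof. by []. Qed.

Lemma lin_linear (F : {linear V -> W}) (f : U -> V) :
  lin f -> lin (fun u => F (f u)).
Proof. by move=> fl a u v; rewrite fl linearP. Qed.

Lemma lin_comp (F : V -> W) (f : U -> V) :
  lin F -> lin f -> lin (fun u => F (f u)).
Proof. by move=> Fl fl a u v; rewrite fl Fl. Qed.

Lemma lin_scaler (c : K) (f : U -> V) : lin f -> lin (fun u => c *: f u).
Proof. by move=> fl a u v; rewrite fl scalerDr !scalerA mulrC. Qed.

Lemma lin_scalel (f : U -> K^o) (w : W) : lin f -> lin (fun u => (f u : K) *: w).
Proof. by move=> fl a u v; rewrite fl scalerDl scalerA. Qed.

Lemma lin_add (f g : U -> V) : lin f -> lin g -> lin (fun u => f u + g u).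
Proof. by move=> fl gl a u v; rewrite fl gl scalerDr addrACA. Qed.

Lemma lin_sub (f g : U -> V) : lin f -> lin g -> lin (fun u => f u - g u).
Proof.
move=> fl gl a u v; rewrite fl gl scalerBr opprD addrACA.
by rewrite -!addrA; congr (_ + _); rewrite addrCA.
Qed.

Lemma lin_sum (I : finType) (F : I -> U -> V) :
  (forall i, lin (F i)) -> lin (fun u => \sum_i F i u).
Proof.
move=> Fl a u v; rewrite scaler_sumr -big_split.
by apply: eq_bigr => i _; rewrite Fl.
Qed.
End LinClosure.

Lemma lin_mull (U : lmodType K) (A : algType K) (f : U -> A) (c : A) :
  lin f -> lin (fun u => f u * c).
Proof. by move=> fl a u v; rewrite fl mulrDl scalerAl. Qed.

Lemma lin_mulr (U : lmodType K) (A : algType K) (c : A) (f : U -> A) :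
  lin f -> lin (fun u => c * f u).
Proof. by move=> fl a u v; rewrite fl mulrDr scalerAr. Qed.

Lemma lin_tensl (U : lmodType K) (V W : vectType K) (f : U -> V) (w : W) :
  lin f -> lin (fun u => f u *t w).
Proof. by move=> fl a u v; rewrite fl tensDl tensZl. Qed.

Lemma lin_tensr (U : lmodType K) (V W : vectType K) (w : W) (f : U -> V) :
  lin f -> lin (fun u => w *t f u).
Proof. by move=> fl a u v; rewrite fl tensDr tensZr. Qed.

Lemma lin_lfunl (U : lmodType K) (V W : vectType K) (f : U -> 'Hom(V, W)) v :
  lin f -> lin (fun u => f u v).
Proof. by move=> fl a x y; rewrite fl add_lfunE scale_lfunE. Qed.

Lemma linfunE (U V : vectType K) (f : U -> V) : lin f -> linfun f =1 f.
Proof.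
move=> fl.
pose F : {linear U -> V} :=
  HB.pack f (GRing.isSemilinear.Build K U V _ f (GRing.semilinear_linear fl)).
exact: (lfunE F).
Qed.
End Linear.

(** * Sweedler sums *)

Section Sweedler.
Variables (K : fieldType) (H : hopfAlgType K).
Local Notation e := (vbasis {:H}).

(* The h_(1)-components of the expansion of the coproduct of h along the basis
   in the second tensor factor. *)
Definition cl (i : 'I_(\dim {:H})) (h : H) : H :=
  tlift (fun a b : H => (coord e i b : K) *: a) (coprod h).

(** Stands for B (h_(1), h_(2)). As a finite sum over a fixed basis it makes sense for every B, and
    nested sums commute by exchange of summation; bilinearity enters only where the tensor itself
    matters. *)
Definition sw (W : lmodType K) (B : H -> H -> W) (h : H) : W :=
  \sum_i B (cl i h) e`_i.

Lemma cl_lin i : lin (cl i).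
Proof. by do 2!apply: lin_linear. Qed.

Lemma eq_sw (W : lmodType K) (B B' : H -> H -> W) h :
  (forall a b, B a b = B' a b) -> sw B h = sw B' h.
Proof. by move=> BB; apply: eq_bigr => i _; apply: BB. Qed.

Lemma lin_sw (U W : lmodType K) (B : H -> H -> W) (f : U -> H) :
  (forall b, lin (B^~ b)) -> lin f -> lin (fun u => sw B (f u)).
Proof.
move=> Bl fl; apply: lin_sum => i; apply: (lin_comp (Bl _)).
exact: (lin_comp (cl_lin i)).
Qed.

Lemma lin_swp (U W : lmodType K) (B : U -> H -> H -> W) h :
  (forall a b, lin (fun u => B u a b)) -> lin (fun u => sw (B u) h).
Proof. by move=> Bl; apply: lin_sum => i; apply: Bl. Qed.

End Sweedler.

Ltac lin := intros;
  repeat first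
  [ assumption
  | apply: lin_id
  | match goal with
    | Hf : lin ?F |- lin (fun x => ?F _) => apply: (lin_comp Hf)
    end
  | apply: lin_mull
  | apply: lin_mulr
  | apply: lin_tensl
  | apply: lin_tensr
  | apply: lin_scalel
  | apply: lin_scaler
  | apply: lin_sw => ?
  | apply: lin_swp => ? ?
  | match goal with
    | Hf : forall v, lin _ |- _ => apply: (lin_comp (Hf _))
    | Hf : forall v w, lin _ |- _ => apply: (lin_comp (Hf _ _))
    end
  | apply: lin_linear
  | apply: lin_lfunl
  | apply: lin_add
  | apply: lin_sub
  | apply: cl_lin
  | apply: lin_sum => ? ].

(** * Traces *)

Section Trace.
Variable K : fieldType.

Definition ltr (V : vectType K) (F : V -> V) : K :=
  \sum_i coord (vbasis {:V}) i (F (vbasis {:V})`_i).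

Lemma form_ext (U : vectType K) (u v : U) :
  (forall p : U -> K^o, lin p -> p u = p v) -> u = v.
Proof.
move=> puv; rewrite [u](coord_vbasis (memvf u)) [v](coord_vbasis (memvf v)).
apply: eq_bigr => i _; congr (_ *: _).
by apply: (puv (coord (vbasis fullv) i : U -> K^o)); lin.
Qed.

Lemma eq_ltr (V : vectType K) (F G : V -> V) : F =1 G -> ltr F = ltr G.
Proof. by move=> FG; apply: eq_bigr => i _; rewrite FG. Qed.

Lemma ltr_lin (U : lmodType K) (V : vectType K) (F : U -> V -> V) :
  (forall v, lin (F^~ v)) -> lin (fun u => ltr (F u) : K^o).
Proof. by move=> Fl; apply: lin_sum => i; apply: lin_linear; apply: Fl. Qed.

Lemma lftrace_ltr (V : vectType K) (F : 'End(V)) : lftrace F = ltr F.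
Proof.
by apply: eq_bigr => i _; rewrite !mxE /= passmx.vecof_delta.
Qed.

Lemma ltr_comm (V W : vectType K) (F : V -> W) (G : W -> V) :
  lin F -> lin G -> ltr (F \o G) = ltr (G \o F).
Proof.
move=> Fl Gl; rewrite /ltr.
transitivity (\sum_(i < \dim {:W}) \sum_(j < \dim {:V})
   coord (vbasis {:V}) j (G (vbasis {:W})`_i)
   * coord (vbasis {:W}) i (F (vbasis {:V})`_j)).
  apply: eq_bigr => i _ /=.
  rewrite {1}[G _](coord_vbasis (memvf _)) (lin_sumE Fl) linear_sum.
  by apply: eq_bigr => j _; rewrite (linZ Fl) linearZ.
rewrite exchange_big; apply: eq_bigr => j _ /=.
rewrite {2}[F _](coord_vbasis (memvf _)) (lin_sumE Gl) linear_sum.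
by apply: eq_bigr => i _; rewrite (linZ Gl) linearZ /= mulrC.
Qed.

Lemma ltr_rank1 (V : vectType K) (p : V -> K^o) (w : V) :
  lin p -> ltr (fun v => (p v : K) *: w) = p w.
Proof.
move=> pl; rewrite /ltr [in RHS](coord_vbasis (memvf w)) (lin_sumE pl).
by apply: eq_bigr => i _; rewrite (linZ pl) linearZ /= mulrC.
Qed.

(** The pairs ([u i], [p i]) form a dual family, not necessarily a basis: F is the sum of the
    rank-one maps v |-> p_i (v) F (u_i), whose traces are p_i (F (u_i)). *)
Lemma ltr_dual (V : vectType K) (I : finType) (u : I -> V) (p : I -> V -> K^o)
    (F : V -> V) : (forall i, lin (p i)) -> lin F ->
  (forall v, v = \sum_i (p i v : K) *: u i) -> ltr F = \sum_i p i (F (u i)).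
Proof.
move=> pl Fl vE.
rewrite (@eq_ltr _ _ (fun v => \sum_i (p i v : K) *: F (u i))) => [|v].
  rewrite {1}/ltr; under eq_bigr do rewrite linear_sum.
  by rewrite exchange_big; apply: eq_bigr => i _; rewrite -(ltr_rank1 _ (pl i)).
by rewrite {1}(vE v) (lin_sumE Fl); apply: eq_bigr => i _; rewrite (linZ Fl).
Qed.

Lemma ltr_id (V : vectType K) : ltr (fun v : V => v) = (\dim {:V})%:R.
Proof.
rewrite /ltr (eq_bigr (fun _ => 1)) => [|i _].
  by rewrite sumr_const card_ord.
by rewrite coord_free ?eqxx // (basis_free (vbasisP _)).
Qed.

Lemma ltr_sum (V : vectType K) (I : finType) (F : I -> V -> V) :
  ltr (fun v => \sum_i F i v) = \sum_i ltr (F i).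
Proof. by rewrite /ltr; under eq_bigr do rewrite linear_sum; rewrite exchange_big. Qed.

Lemma ltrZ (V : vectType K) (c : K) (F : V -> V) :
  ltr (fun v => c *: F v) = c * ltr F.
Proof. by rewrite /ltr mulr_sumr; apply: eq_bigr => i _; rewrite linearZ. Qed.

Lemma lin_coordE (V : vectType K) (W : lmodType K) (X : V -> W) z : lin X ->
  \sum_i (coord (vbasis {:V}) i z : K) *: X (vbasis {:V})`_i = X z.
Proof.
move=> Xl; rewrite [in RHS](coord_vbasis (memvf z)) (lin_sumE Xl).
by apply: eq_bigr => i _; rewrite (linZ Xl).
Qed.
End Trace.

Section Eigen.
Variables (K : closedFieldType) (V : vectType K).

Lemma ltr_eigen (F : V -> V) : lin F -> exists s : seq K,
  [/\ size s = \dim {:V}, ltr F = \sum_(a <- s) a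
    & forall a, (a \in s) <-> (exists2 v, v != 0 & F v = a *: v)].
Proof.
move=> Fl; pose M := passmx.mxof (vbasis {:V}) (vbasis {:V}) (linfun F).
have trM : ltr F = \tr M.
  by rewrite -[\tr M]/(lftrace _) lftrace_ltr; apply: eq_ltr => v; rewrite linfunE.
have [s Ds] := closed_field_poly_normal (char_poly M).
rewrite (eqP (char_poly_monic M)) scale1r in Ds.
exists s; have szs : size s = \dim {:V}.
  by have := size_char_poly M; rewrite Ds size_prod_XsubC => -[].
split=> //.
  case: (posnP (\dim {:V})) => [n0|n_gt0].
    have s0 : s = [::] by apply: size0nil; rewrite szs.
    by rewrite s0 big_nil /ltr big1 // => i _; have := ltn_ord i; rewrite [X in (_ < X)%N]n0.
  have := char_poly_trace M n_gt0; rewrite Ds -trM -szs coefPn_prod_XsubC.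
    by move/oppr_inj.
  by rewrite szs -lt0n.
move=> a; rewrite -root_prod_XsubC -Ds -eigenvalue_root_char.
split=> [/eigenvalueP[v]|[v v0 Fv]]; last apply/eigenvalueP.
- move=> vM v0; exists (passmx.vecof (vbasis {:V}) v).
    by rewrite passmx.vecof_eq0 // ?vbasisP.
  rewrite -(linfunE Fl) (passmx.hom_vecof _ (vbasisP _)) -/M vM.
  exact: (linZ (@passmx.vecof_linear _ _ _)).
- exists (passmx.rVof (vbasis {:V}) v); last first.
    by rewrite passmx.rVof_eq0 // vbasisP.
  by rewrite /M -passmx.rVof_app ?vbasisP // linfunE // Fv (linZ (@passmx.rVof_linear _ _ _)).
Qed.

End Eigen.

(** * Sweedler calculus and the antipode *)

Section SweedlerCalculus.
Variables (K : fieldType) (H : hopfAlgType K).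
Local Notation e := (vbasis {:H}).
Local Notation eps := (counit : H -> K^o).
Local Notation S := (antipode : H -> H).

Lemma coprodE h : coprod h = sw (@tens K H H) h.
Proof.
rewrite /sw /cl; elim/tensor_ind: (coprod h) => [a b|s t {1}-> {1}->].
  rewrite {1}[b](coord_vbasis (memvf b)) tens_sumr; apply: eq_bigr => i _.
  rewrite tliftE ?tensZr ?tensZl // => ? ? ? ?.
    by rewrite scalerDr !scalerA mulrC.
  by rewrite linearP scalerDl scalerA.
by rewrite -big_split; apply: eq_bigr => i _; rewrite linearD tensDl.
Qed.

Lemma swE (W : vectType K) (B : H -> H -> W) h :
    (forall b, lin (B^~ b)) -> (forall a, lin (B a)) ->
  sw B h = tlift B (coprod h).
Proof.
move=> Bl Br; rewrite coprodE linear_sum.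
by apply: eq_bigr => i _ /=; rewrite tliftE.
Qed.

Lemma sw_lin (V W : lmodType K) (G : V -> W) (B : H -> H -> V) h :
  lin G -> G (sw B h) = sw (fun a b => G (B a b)) h.
Proof. by move=> Gl; rewrite (lin_sumE Gl). Qed.

Lemma sw_exch (W : lmodType K) (B : H -> H -> H -> H -> W) g h :
  sw (fun a b => sw (B a b) g) h = sw (fun c d => sw (fun a b => B a b c d) h) g.
Proof. exact: exchange_big. Qed.

(** Coassociativity: both sides are values of the linear map on H (x) (H (x) H) induced by [T], at
    the two forms of the iterated coproduct. *)
Lemma swA (W : vectType K) (T : H -> H -> H -> W) h :
    (forall b c, lin (fun a => T a b c)) -> (forall a c, lin (fun b => T a b c)) ->
    (forall a b, lin (T a b)) ->
  sw (fun a b => sw (T a) b) h = sw (fun a b => sw (fun c d => T c d b) a) h.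
Proof.
move=> T1 T2 T3.
pose F : 'Hom(tensor H (tensor H H), W) := tlift (fun a s => tlift (T a) s).
have FE a b c : F (a *t (b *t c)) = T a b c.
  rewrite /F tliftE; [by rewrite tliftE; [|exact: T2|exact: T3] | |
    by move=> ? ? ? ?; rewrite linearP].
  by move=> s; apply: (@linear_tliftr _ _ _ _ _ T s).
have Eq : F (tassoc H H H (tmap coprod \1 (coprod h))) = F (tmap \1 coprod (coprod h)).
  by rewrite -[tmap \1 coprod _]comp_lfunE -coprodA !comp_lfunE.
move: Eq; rewrite coprodE !linear_sum /= => Eq; transitivity
  (\sum_i F (tmap \1 coprod (cl i h *t e`_i))).
  apply: eq_bigr => i _; rewrite tmapE id_lfunE (coprodE e`_i) tens_sumr linear_sum.
  by apply: eq_bigr => j _; rewrite /= FE.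
rewrite -Eq; apply: eq_bigr => i _.
rewrite tmapE id_lfunE (coprodE (cl i h)) tens_suml !linear_sum.
by apply: eq_bigr => j _; rewrite /= tassocE FE.
Qed.

Lemma swM (W : vectType K) (B : H -> H -> W) g h :
    (forall b, lin (B^~ b)) -> (forall a, lin (B a)) ->
  sw B (g * h) = sw (fun a b => sw (fun c d => B (a * c) (b * d)) h) g.
Proof.
move=> Bl Br; rewrite swE // coprodM !coprodE mulr_suml linear_sum.
apply: eq_bigr => i _; rewrite mulr_sumr linear_sum; apply: eq_bigr => j _.
by rewrite tensM /= tliftE.
Qed.

Lemma sw1 (W : vectType K) (B : H -> H -> W) :
  (forall b, lin (B^~ b)) -> (forall a, lin (B a)) -> sw B 1 = B 1 1.
Proof. by move=> Bl Br; rewrite swE // coprod1 tliftE. Qed.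

Lemma sw_counitl (W : lmodType K) (G : H -> W) h :
  lin G -> sw (fun a b => (eps a : K) *: G b) h = G h.
Proof.
move=> Gl; rewrite -{2}(counitl h) -swE; [|by lin..].
by rewrite (sw_lin _ _ Gl); apply: eq_sw => a b; rewrite (linZ Gl).
Qed.

Lemma sw_counitr (W : lmodType K) (G : H -> W) h :
  lin G -> sw (fun a b => (eps b : K) *: G a) h = G h.
Proof.
move=> Gl; rewrite -{2}(counitr h) -swE; [|by lin..].
by rewrite (sw_lin _ _ Gl); apply: eq_sw => a b; rewrite (linZ Gl).
Qed.

Lemma sw_antipodel (W : lmodType K) (G : H -> W) h :
  lin G -> sw (fun a b => G (S a * b)) h = (eps h : K) *: G 1.
Proof.
move=> Gl; rewrite -(linZ Gl) -antipodel -swE; [|by lin..].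
by rewrite (sw_lin _ _ Gl).
Qed.

Lemma sw_antipoder (W : lmodType K) (G : H -> W) h :
  lin G -> sw (fun a b => G (a * S b)) h = (eps h : K) *: G 1.
Proof.
move=> Gl; rewrite -(linZ Gl) -antipoder -swE; [|by lin..].
by rewrite (sw_lin _ _ Gl).
Qed.

End SweedlerCalculus.

Section Antipode.
Variables (K : fieldType) (H : hopfAlgType K).
Local Notation eps := (counit : H -> K^o).
Local Notation S := (antipode : H -> H).

(** In the convolution algebra Hom (H, W), a left inverse F and a right inverse G of M coincide: F =
    F M G = G. *)
Lemma conv_uniq (W : falgType K) (F M G : H -> W) :
    lin F -> lin M -> lin G ->
    (forall h, sw (fun a b => F a * M b) h = (eps h : K) *: 1) ->
    (forall h, sw (fun a b => M a * G b) h = (eps h : K) *: 1) ->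
  F =1 G.
Proof.
move=> Fl Ml Gl FM MG h.
transitivity (sw (fun a b => sw (fun c d => F a * (M c * G d)) b) h).
  rewrite -[LHS](sw_counitr _ Fl); apply: eq_sw => a b.
  by rewrite -(sw_lin _ _ (@lin_mulr _ _ _ (F a) _ (@lin_id _ _))) MG -scalerAr mulr1.
rewrite swA; [|by lin..].
rewrite -[RHS](sw_counitl _ Gl); apply: eq_sw => a b.
transitivity (sw (fun c d => F c * M d * G b) a).
  by apply: eq_sw => c d; rewrite mulrA.
by rewrite -(sw_lin _ _ (@lin_mull _ _ _ _ (G b) (@lin_id _ _))) FM -scalerAl mul1r.
Qed.

(** This is F * id * S = F under convolution, S being the inverse of the identity. *)
Lemma convK (F : H -> H) h :
  lin F -> sw (fun a b => sw (fun c d => F c * d) a * S b) h = F h.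
Proof.
move=> Fl; rewrite -[RHS](sw_counitr _ Fl).
transitivity (sw (fun a b => sw (fun c d => F c * d * S b) a) h).
  by apply: eq_sw => a b; rewrite (sw_lin _ _ (@lin_mull _ _ _ _ (S b) (@lin_id _ _))).
rewrite -(swA (T := fun a c d => F a * c * S d)); [|by lin..].
apply: eq_sw => a b; rewrite -[in RHS](mulr1 (F a)).
rewrite -(sw_antipoder (G := fun z => F a * z)); last by lin.
by apply: eq_sw => c d; rewrite mulrA.
Qed.

Lemma antipode1 : S 1 = 1.
Proof.
have := sw_antipodel (1 : H) (@lin_id _ H).
by rewrite sw1; [rewrite counit1 scale1r mulr1 | lin..].
Qed.

Lemma counit_antipode h : eps (S h) = eps h.
Proof.
have epsl : lin eps by lin.
have Sl : lin (fun h => eps (S h)) by lin.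
rewrite -(sw_counitr h Sl).
transitivity (sw (fun a b => eps (S a * b)) h).
  by apply: eq_sw => a b; rewrite counitM /= mulrC.
by rewrite (sw_antipodel _ epsl) counit1 [_ *: _]mulr1.
Qed.

(** Two uses of [convK]. In the second variable it gives S (a_(1) b) a_(2) = eps (a) S (b), and then
    in the first variable S (a b) = S (a_(1) b) a_(2) S (a_(3)) = S (b) S (a). *)
Lemma antipodeM a b : S (a * b) = S b * S a.
Proof.
have S1 a' b' : sw (fun x y => S (x * b') * y) a' = (eps a' : K) *: S b'.
  pose F c := sw (fun x y => S (x * c) * y) a'.
  have Fl : lin F by rewrite /F; lin.
  rewrite -/(F b') -(convK b' Fl).
  have lG : lin (fun z => (eps a' : K) *: S z) by lin.
  rewrite -(sw_counitl b' lG); apply: eq_sw => x y.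
  suff -> : sw (fun c d => F c * d) x = (eps a' * eps x : K) *: 1.
    by rewrite -scalerAl mul1r scalerA mulrC.
  rewrite -counitM.
  rewrite -[RHS](sw_antipodel _ (@lin_id _ H)) swM; [|by lin..].
  rewrite -sw_exch; apply: eq_sw => c d.
  rewrite /F (sw_lin _ _ (@lin_mull _ _ _ _ d (@lin_id _ _))).
  by apply: eq_sw => ? ?; rewrite mulrA.
have Fl : lin (fun a => S (a * b)) by lin.
rewrite -(convK a Fl).
have Gl : lin (fun z => S b * S z) by lin.
rewrite -(sw_counitl a Gl); apply: eq_sw => x y.
by rewrite S1 scalerAl.
Qed.

(** The left side is a left, and the right side a right, convolution inverse of [coprod] in Hom (H,
    H (x) H). *)
Lemma coprod_antipode h : coprod (S h) = sw (fun a b => S b *t S a) h.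
Proof.
pose G := sw (fun a b => S b *t S a).
apply: (@conv_uniq (tensor H H) (fun h => coprod (S h)) coprod G).
- by lin.
- by lin.
- by rewrite /G; lin.
- move=> {}h; rewrite -(@coprod1 _ H) -(sw_antipodel h (G := coprod)); last by lin.
  by apply: eq_sw => a b; rewrite coprodM.
move=> {}h.
transitivity (sw (fun a b => sw (fun c d => sw (fun x y =>
    (c * S y) *t (d * S x)) b) a) h).
  apply: eq_sw => a b; rewrite coprodE /G mulr_suml; apply: eq_bigr => i _.
  by rewrite mulr_sumr; apply: eq_bigr => j _; rewrite tensM.
rewrite -(swA (T := fun c d b => sw (fun x y => (c * S y) *t (d * S x)) b));
  [|by lin..].
rewrite -(sw_antipoder h (G := fun z => z *t (1 : H))); last by lin.
apply: eq_sw => c b.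
rewrite swA; [|by lin..].
rewrite -(sw_counitl b (G := fun b => (c * S b) *t (1 : H))); last by lin.
apply: eq_sw => d y.
by rewrite (sw_antipoder d (G := fun z => (c * S y) *t z)); last lin.
Qed.

Lemma sw_antipode (W : vectType K) (B : H -> H -> W) h :
    (forall b, lin (B^~ b)) -> (forall a, lin (B a)) ->
  sw B (S h) = sw (fun a b => B (S b) (S a)) h.
Proof.
move=> Bl Br; rewrite swE // coprod_antipode linear_sum.
by apply: eq_bigr => i _ /=; rewrite tliftE.
Qed.

End Antipode.

(** * Integrals *)

Section Ideal.
Variables (K : fieldType) (A : falgType K).

(** Take a left ideal J complementary to I and write 1 = e + w with w in J; for x in I, x w lies in
    both I and J, hence is 0. *)
Lemma ideal_unit (I : {vspace A}) : semisimple_algebra A ->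
    (forall a x, x \in I -> a * x \in I) -> (forall a x, x \in I -> x * a \in I) ->
  exists2 e, e \in I & forall x, x \in I -> x * e = x.
Proof.
move=> ssA Il Ir.
have act a x : mact (regular_module A) a x = a * x by rewrite !lfunE.
have [J subJ [IJ IJ0]] : exists2 J : {vspace A}, @submodule _ _ (regular_module A) J
    & (I + J = fullv)%VS /\ (I :&: J = 0)%VS.
  by apply: ssA => a u uI; rewrite act; apply: Il.
have /memv_addP[e eI [w wJ ew]] : (1 : A) \in (I + J)%VS by rewrite IJ memvf.
exists e => // x xI.
have xw : x * w \in (I :&: J)%VS by rewrite memv_cap Ir // -act; apply: subJ.
rewrite IJ0 memv0 in xw.
by rewrite -[RHS]mulr1 ew mulrDr (eqP xw) addr0.
Qed.
End Ideal.

Section Integral.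
Variables (K : fieldType) (H : hopfAlgType K) (L : H).
Local Notation eps := (counit : H -> K^o).
Local Notation S := (antipode : H -> H).
Hypothesis Lint : two_sided_integral L.

(** Write L_(1) a (x) L_(2) as L_(1) a_(1) (x) L_(2) a_(2) S (a_(3)); apart from S (a_(3)), this is
    the coproduct of L a_(1) = eps (a_(1)) L. *)
Lemma int_mulr (W : vectType K) (B : H -> H -> W) a :
    (forall b, lin (B^~ b)) -> (forall a, lin (B a)) ->
  sw (fun x y => B (x * a) y) L = sw (fun x y => B x (y * S a)) L.
Proof.
move=> Bl Br.
transitivity (sw (fun a1 a' => sw (fun a2 a3 =>
    sw (fun x y => B (x * a1) (y * (a2 * S a3))) L) a') a).
  rewrite -(sw_counitr a (G := fun a1 => sw (fun x y => B (x * a1) y) L)); last by lin.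
  apply: eq_sw => a1 a'.
  rewrite (sw_antipoder a' (G := fun z => sw (fun x y => B (x * a1) (y * z)) L)); last by lin.
  by congr (_ *: _); apply: eq_sw => x y; rewrite mulr1.
rewrite swA; [|by lin..].
rewrite -(sw_counitl a (G := fun z => sw (fun x y => B x (y * S z)) L)); last by lin.
apply: eq_sw => a' a3.
have swl : lin (sw (fun x y => B x (y * S a3))) by lin.
rewrite -(linZ swl) -(Lint a').2 swM; [|by lin..].
rewrite -sw_exch; apply: eq_sw => x y; apply: eq_sw => a1 a2.
by rewrite mulrA.
Qed.

Lemma int_mull (W : vectType K) (B : H -> H -> W) a :
    (forall b, lin (B^~ b)) -> (forall a, lin (B a)) ->
  sw (fun x y => B x (a * y)) L = sw (fun x y => B (S a * x) y) L.
Proof.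
move=> Bl Br; symmetry.
transitivity (sw (fun a1 a' => sw (fun a2 a3 =>
    sw (fun x y => B (S a1 * (a2 * x)) (a3 * y)) L) a') a).
  rewrite -(sw_counitr a (G := fun a1 => sw (fun x y => B (S a1 * x) y) L)); last by lin.
  apply: eq_sw => a1 a'.
  have swl : lin (sw (fun x y => B (S a1 * x) y)) by lin.
  by rewrite -(linZ swl) -(Lint a').1 swM; [|by lin..].
rewrite swA; [|by lin..].
rewrite -(sw_counitl a (G := fun z => sw (fun x y => B x (z * y)) L)); last by lin.
apply: eq_sw => a' a3.
transitivity (sw (fun c d => sw (fun x y => B (S c * d * x) (a3 * y)) L) a').
  by apply: eq_sw => c d; apply: eq_sw => x y; rewrite mulrA.
rewrite (sw_antipodel a' (G := fun z => sw (fun x y => B (z * x) (a3 * y)) L)); last by lin.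
by congr (_ *: _); apply: eq_sw => x y; rewrite mul1r.
Qed.

(** The kernel of S is a two-sided ideal, hence has a right unit u. For z in it, z = z L_(1) S
    (L_(2)) = z L_(1) u S (L_(2)) = z L_(1) S (L_(2) S (u)) = 0, the third equality being
    [int_mulr]. *)
Lemma antipode_inj : semisimple_algebra H -> eps L = 1 -> injective S.
Proof.
move=> ssH eL.
pose I := lker (antipode : 'End(H)); suff kS : I == 0%VS by apply/lker0P.
rewrite -subv0; apply/subvP => z zI.
have SI x : x \in I -> S x = 0 by rewrite memv_ker => /eqP.
have IS x : S x = 0 -> x \in I by rewrite memv_ker => /eqP.
have [u uI uK] : exists2 u : H, u \in I & forall x : H, x \in I -> x * u = x.
  apply: (ideal_unit ssH) => a x xI; apply: IS; rewrite antipodeM (SI _ xI).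
    by rewrite mul0r.
  by rewrite mulr0.
rewrite memv0; apply/eqP.
have -> : z = sw (fun x y => z * (x * S y)) L.
  by rewrite (sw_antipoder L (G := fun v => z * v)) ?eL ?scale1r ?mulr1 //; lin.
transitivity (sw (fun x y => z * (x * u) * S y) L).
  apply: eq_sw => x y; rewrite !mulrA (uK (z * x)) //.
  by apply: IS; rewrite antipodeM (SI _ zI) mulr0.
rewrite (int_mulr (B := fun x y => z * x * S y) u); [|by lin..].
by rewrite /sw big1 // => i _; rewrite (SI _ uI) mulr0 linear0 mulr0.
Qed.

End Integral.

(** * The regular trace twisted by the inverse square of the antipode *)

Section InverseAntipode.
Variables (K : fieldType) (H : hopfAlgType K) (Si : H -> H).
Local Notation e := (vbasis {:H}).
Local Notation eps := (counit : H -> K^o).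
Local Notation S := (antipode : H -> H).
Hypotheses (SK : cancel S Si) (SiK : cancel Si S).

Lemma Si_lin : lin Si.
Proof. by move=> a u v; rewrite -{1}(SiK u) -{1}(SiK v) -linearP SK. Qed.
Local Notation Sil := Si_lin.

Lemma SiM a b : Si (a * b) = Si b * Si a.
Proof. by rewrite -{1}(SiK a) -{1}(SiK b) -antipodeM SK. Qed.

Lemma Si1 : Si 1 = 1.
Proof. by rewrite -{1}(antipode1 H) SK. Qed.

Lemma sw_Si (W : vectType K) (B : H -> H -> W) v :
    (forall b, lin (B^~ b)) -> (forall a, lin (B a)) ->
  sw B (Si v) = sw (fun a b => B (Si b) (Si a)) v.
Proof.
have Sil' := Sil; move=> Bl Br; rewrite -[in RHS](SiK v) sw_antipode; [|by lin..].
by apply: eq_sw => a b; rewrite !SK.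
Qed.

Lemma sw_SiSi (W : vectType K) (B : H -> H -> W) v :
    (forall b, lin (B^~ b)) -> (forall a, lin (B a)) ->
  sw B (Si (Si v)) = sw (fun a b => B (Si (Si a)) (Si (Si b))) v.
Proof. by have Sil' := Sil; move=> Bl Br; rewrite !sw_Si; lin. Qed.

Lemma sw_skew (W : lmodType K) (G : H -> W) h :
  lin G -> sw (fun a b => G (b * Si a)) h = (eps h : K) *: G 1.
Proof.
have Sil' := Sil; move=> Gl; rewrite -[X in _ *: G X]Si1.
rewrite -(sw_antipoder h (G := fun z => G (Si z))); last by lin.
by apply: eq_sw => a b; rewrite SiM SK.
Qed.

Definition right_int (h : H) : K^o := ltr (fun y : H => Si (Si (h * y))).
Local Notation f := right_int.

Lemma right_int_lin : lin right_int.
Proof. by have Sil' := Sil; apply: ltr_lin; lin. Qed.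
Local Notation fl := right_int_lin.

(* The partial trace over y of y |-> Si (Si (h_(1) * y)) (x) h_(2) is computed
   by inserting h_(2) = h_(2) * y_(2) * S y_(3) and moving the factor depending
   on y alone to the front by cyclicity; there it meets its skew inverse. *)
Lemma right_int_int h : sw (fun a b => (f a : K) *: b) h = (f h : K) *: 1.
Proof.
have Sil' := Sil; have fl' := fl.
apply: form_ext => p pl; rewrite (sw_lin _ _ pl) (linZ pl).
(* [P k] and [Q k] split off S (y_(2)) along the basis: summed over k, [P k \o Q k] is y |-> p
   (h_(2)) S^-2 (h_(1) y), and [Q k \o P k] is v |-> p (1) h S^-2 (v). *)
pose P (k : 'I_(\dim {:H})) v := sw (fun a b => (p (b * e`_k) : K) *: Si (Si a)) v.
pose Q k y := sw (fun a b => (coord e k (S b) : K) *: (h * a)) y.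
have Pl k : lin (P k) by rewrite /P; lin.
have Ql k : lin (Q k) by rewrite /Q; lin.
transitivity (\sum_(k < \dim {:H}) ltr (P k \o Q k)).
  rewrite -ltr_sum.
  transitivity (ltr (fun y : H => sw (fun a b => (p b : K) *: Si (Si (a * y))) h)).
    by rewrite /sw ltr_sum; apply: eq_bigr => j _; rewrite ltrZ (linZ pl) mulrC.
  refine (@eq_ltr K H _ _ _) => y /=.
  transitivity (sw (fun a b =>
     sw (fun c d => (p (d * S b) : K) *: Si (Si c)) (h * a)) y); last first.
    under [RHS]eq_bigr => k _ do rewrite (sw_lin _ _ (Pl k)).
    rewrite [RHS]exchange_big; apply: eq_bigr => j _ /=.
    rewrite -(lin_coordE (X := fun z =>
      sw (fun c d => (p (d * z) : K) *: Si (Si c)) (h * cl j y))); last by lin.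
    by apply: eq_bigr => k _; rewrite (linZ (Pl k)).
  transitivity (sw (fun a b => sw (fun c d => sw (fun c' d' =>
     (p (d * d' * S b) : K) *: Si (Si (c * c'))) a) h) y); last first.
    by apply: eq_sw => a b; rewrite swM; lin.
  rewrite sw_exch; apply: eq_sw => c d.
  rewrite -(swA (T := fun a x z => (p (d * x * S z) : K) *: Si (Si (c * a))));
    [|by lin..].
  rewrite -(sw_counitr y (G := fun a => (p d : K) *: Si (Si (c * a)))); last by lin.
  apply: eq_sw => a b; rewrite -[d in LHS]mulr1.
  rewrite -(sw_antipoder b (G := fun z => (p (d * z) : K) *: Si (Si (c * a)))); last by lin.
  by apply: eq_sw => x z; rewrite mulrA.
under eq_bigr => k _ do rewrite (ltr_comm (Pl k) (Ql k)).
rewrite -ltr_sum; transitivity (ltr (fun v : H => (p 1 : K) *: (h * Si (Si v)))).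
  refine (@eq_ltr K H _ _ _) => v /=.
  under eq_bigr => k _ do rewrite (sw_lin _ _ (Ql k)).
  rewrite [LHS]exchange_big /=.
  transitivity (sw (fun a b => sw (fun c d => (p (b * Si d) : K) *: (h * Si (Si c))) a) v).
    apply: eq_bigr => j _.
    transitivity (\sum_(k < \dim {:H}) sw (fun c d => (p (e`_j * e`_k) : K) *:
       ((coord e k (S (Si (Si d))) : K) *: (h * Si (Si c)))) (cl j v)).
      apply: eq_bigr => k _; rewrite (linZ (Ql k)) /Q sw_SiSi; [|by lin..].
      by rewrite (sw_lin _ _ (@lin_scaler _ _ _ _ _ (@lin_id _ _))).
    rewrite [LHS]exchange_big; apply: eq_bigr => i _ /=.
    rewrite -(lin_coordE (X := fun z => (p (e`_j * z) : K) *: (h * Si (Si (cl i (cl j v))))));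
      last by lin.
    by apply: eq_bigr => k _; rewrite SiK !scalerA mulrC.
  rewrite -(swA (T := fun c d b => (p (b * Si d) : K) *: (h * Si (Si c)))); [|by lin..].
  rewrite -(sw_counitr v (G := fun c => (p 1 : K) *: (h * Si (Si c)))); last by lin.
  apply: eq_sw => c z.
  by rewrite (sw_skew z (G := fun u => (p u : K) *: (h * Si (Si c)))); last lin.
rewrite ltrZ mulrC; congr (_ * _).
have Rl : lin (fun y => Si (Si y)) by lin.
have hl : lin (fun y => h * y) by lin.
exact: (ltr_comm hl Rl).
Qed.

End InverseAntipode.

(** * The Frobenius form, the distinguished grouplike and the Drinfeld element *)

Section FrobeniusForm.
Variables (K : fieldType) (H : hopfAlgType K) (Si : H -> H) (L : H).
Local Notation e := (vbasis {:H}).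
Local Notation eps := (counit : H -> K^o).
Local Notation S := (antipode : H -> H).
Hypotheses (SK : cancel S Si) (SiK : cancel Si S).
Hypotheses (Lint : two_sided_integral L) (eL : eps L = 1).
Local Notation f := (right_int Si).
Local Notation Sil := (Si_lin SK SiK).
Local Notation fl := (right_int_lin SK SiK).

Lemma right_intL : f L = 1.
Proof.
have Sil' := Sil.
have -> : f L = ltr (fun y : H => (eps y : K) *: Si (Si L)).
  by refine (@eq_ltr K H _ _ _) => y; rewrite (Lint y).2 !(linZ Sil').
rewrite ltr_rank1; last by lin.
by rewrite -(counit_antipode (Si (Si L))) SiK -counit_antipode SiK.
Qed.

(** Cyclicity moves multiplication by b in front of S^-2, and passing it back through S^-2 turns b
    into S^2 (b). *)
Lemma right_int_cyc a b : f (a * b) = f (S (S b) * a).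
Proof.
have Sil' := Sil.
have Fl : lin (fun y => b * y) by lin.
have Gl : lin (fun y => Si (Si (a * y))) by lin.
have -> : f (a * b) = ltr ((fun y => Si (Si (a * y))) \o (fun y => b * y)).
  by refine (@eq_ltr K H _ _ _) => y /=; rewrite mulrA.
rewrite (ltr_comm Gl Fl); refine (@eq_ltr K H _ _ _) => y /=.
by rewrite -mulrA (SiM SK SiK (S (S b))) SK (SiM SK SiK _ (S b)) SK.
Qed.

Lemma casimir (W : vectType K) (B : H -> H -> W) a :
    (forall b, lin (B^~ b)) -> (forall a, lin (B a)) ->
  sw (fun x y => B (a * x) (S y)) L = sw (fun x y => B x (S y * a)) L.
Proof.
move=> Bl Br; rewrite -{1}(SiK a).
rewrite -(int_mull Lint (B := fun x y => B x (S y))); [|by lin..].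
by apply: eq_sw => x y; rewrite antipodeM SiK.
Qed.

(** So f is a Frobenius form with dual bases L_(1) and S (L_(2)). Pull a to the right by [casimir];
    then f (L_(1)) L_(2) = f (L) 1 = 1. *)
Lemma right_int_dual a : sw (fun x y => (f (a * x) : K) *: S y) L = a.
Proof.
have fl' := fl.
rewrite (casimir (B := fun x y => (f x : K) *: y)); [|by lin..].
transitivity (sw (fun x y => (fun z => S z * a) ((f x : K) *: y)) L).
  by apply: eq_sw => x y /=; rewrite !linearZ /= scalerAl.
rewrite -(sw_lin _ _ (G := fun z => S z * a)); last by lin.
by rewrite (right_int_int SK SiK) right_intL scale1r antipode1 mul1r.
Qed.

Lemma ltr_right_int (F : H -> H) : lin F -> ltr F = sw (fun x y => f (F (S y) * x)) L.
Proof.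
have fl' := fl; move=> Fl.
refine (@ltr_dual K H 'I_(\dim {:H}) (fun i => S e`_i) (fun i v => f (v * cl i L)) F _ Fl _).
  by move=> i; lin.
by move=> v; rewrite -[LHS]right_int_dual.
Qed.

(* The map sending a form p to p L_(1) * L_(2) is onto by [right_int_dual], hence
   one-to-one by dimension. *)
Lemma int_form_inj (p : H -> K^o) : lin p ->
  sw (fun x y => (p x : K) *: y) L = 0 -> forall h, p h = 0.
Proof.
have fl' := fl; move=> pl p0 h.
pose D (q : 'Hom(H, K^o)) := sw (fun x y => (q x : K) *: y) L.
have Dl : lin D.
  by apply: lin_swp => x y; apply: lin_scalel => a u v; rewrite add_lfunE scale_lfunE.
pose DD := linfun D.
have DDim : limg DD = fullv.
  apply/vspaceP => a; rewrite memvf; apply/memv_imgP.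
  have ql : lin (fun x => f (S a * x)) by lin.
  exists (linfun (fun x => f (S a * x))); first exact: memvf.
  rewrite linfunE // /D.
  transitivity (sw (fun x y => (f (S a * x) : K) *: y) L); last first.
    by apply: eq_sw => x y; rewrite linfunE.
  rewrite -(int_mull Lint (B := fun x y => (f x : K) *: y)); [|by lin..].
  transitivity (sw (fun x y => (fun z => a * z) ((f x : K) *: y)) L).
    rewrite -(sw_lin _ _ (G := fun z => a * z)); last by lin.
    by rewrite (right_int_int SK SiK) right_intL scale1r mulr1.
  by apply: eq_sw => x y; rewrite scalerAr.
have ker0 : lker DD == 0%VS.
  have := limg_ker_dim DD fullv; rewrite DDim capfv !dimvf.
  rewrite [dim 'Hom(H, K^o)]muln1 => /eqP; rewrite -{2}[dim H]add0n eqn_add2r.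
  by rewrite -dimv_eq0.
have: linfun p \in lker DD.
  rewrite memv_ker linfunE // /D -p0; apply/eqP; apply: eq_sw => x y.
  by rewrite linfunE.
rewrite (eqP ker0) memv0 => /eqP p0'.
by rewrite -(linfunE pl) p0' zero_lfunE.
Qed.

Definition dist_glike : H := sw (fun x y => (f y : K) *: x) L.
Local Notation g := dist_glike.

(** For b = S^3 (a), S (b) g is L_(1) f (b L_(2)) while g a is L_(1) f (L_(2) S (a));
    [right_int_cyc] makes the two equal. *)
Lemma SSSS_dist_glike a : S (S (S (S a))) * g = g * a.
Proof.
have fl' := fl.
have E1 b : sw (fun x y => (f (b * y) : K) *: x) L = S b * g.
  rewrite (int_mull Lint (B := fun x y => (f y : K) *: x)); [|by lin..].
  rewrite (sw_lin _ _ (G := fun z => S b * z)); last by lin.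
  by apply: eq_sw => x y; rewrite scalerAr.
have E2 b : sw (fun x y => (f (y * S b) : K) *: x) L = g * b.
  rewrite -(int_mulr Lint (B := fun x y => (f y : K) *: x)); [|by lin..].
  rewrite (sw_lin _ _ (G := fun z => z * b)); last by lin.
  by apply: eq_sw => x y; rewrite scalerAl.
by rewrite -E1 -E2; apply: eq_sw => x y; rewrite (right_int_cyc y).
Qed.

(** Composed with any form p, the difference [psi] of the two sides is again a right integral, and
    psi (L) = 0 by the choice of g; hence psi (L_(1)) L_(2) = 0 and [int_form_inj] gives psi = 0. *)
Lemma right_int_left h : sw (fun a b => (f b : K) *: a) h = (f h : K) *: g.
Proof.
have fl' := fl.
apply: form_ext => p pl; apply/eqP; rewrite -subr_eq0; apply/eqP.
pose psi z : K^o := p (sw (fun a b => (f b : K) *: a) z) - p ((f z : K) *: g).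
rewrite -[LHS]/(psi h); apply: int_form_inj; first by rewrite /psi; lin.
have psiE z : sw (fun a b => (psi a : K) *: b) z = (psi z : K) *: 1.
  rewrite /psi scalerBl -(linZ (@lin_id _ _)).
  transitivity (sw (fun a b => (p (sw (fun c d => (f d : K) *: c) a) : K) *: b) z
              - sw (fun a b => (p ((f a : K) *: g) : K) *: b) z).
    by rewrite /sw -sumrB; apply: eq_bigr => i _; rewrite scalerBl.
  congr (_ - _).
    transitivity (sw (fun a b => sw (fun c d => (f d : K) *: ((p c : K) *: b)) a) z).
      apply: eq_sw => a b; rewrite (sw_lin _ _ (G := fun z => (p z : K) *: b)); last by lin.
      by apply: eq_sw => c d; rewrite (linZ pl) -scalerA.
    rewrite -(swA (T := fun c d b => (f d : K) *: ((p c : K) *: b))); [|by lin..].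
    rewrite (sw_lin _ _ (G := fun z => (p z : K) *: (1 : H))); last by lin.
    apply: eq_sw => c y; rewrite (linZ pl) -scalerA scalerA mulrC -scalerA.
    rewrite -(right_int_int SK SiK) (sw_lin _ _ (G := fun z => (p c : K) *: z)); last by lin.
    by apply: eq_sw => d b; rewrite !scalerA mulrC.
  transitivity (sw (fun a b => (p g : K) *: ((f a : K) *: b)) z).
    by apply: eq_sw => a b; rewrite (linZ pl) scalerA mulrC.
  rewrite -(sw_lin _ _ (G := fun z => (p g : K) *: z)); last by lin.
  by rewrite (right_int_int SK SiK) (linZ pl) scalerA mulrC.
by rewrite psiE /psi -/g right_intL scale1r subrr scale0r.
Qed.

Lemma sw_dist_glike (W : vectType K) (B : H -> H -> W) :
    (forall b, lin (B^~ b)) -> (forall a, lin (B a)) -> sw B g = B g g.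
Proof.
have fl' := fl; move=> Bl Br.
have swl : lin (sw B) by lin.
rewrite {1}/g (sw_lin _ _ swl).
transitivity (sw (fun x y => sw (fun a b => (f y : K) *: B a b) x) L).
  apply: eq_sw => x y; rewrite (linZ swl).
  by rewrite (sw_lin _ _ (@lin_scaler _ _ _ _ _ (@lin_id _ _))).
rewrite -(swA (T := fun a b y => (f y : K) *: B a b)); [|by lin..].
rewrite [in RHS]/g (sw_lin _ _ (Bl g)); apply: eq_sw => a z.
rewrite (linZ (Bl g)) -(linZ (Br a)) -right_int_left (sw_lin _ _ (Br a)).
by apply: eq_sw => b y; rewrite (linZ (Br a)).
Qed.

Lemma dist_glike_inv : g * S g = 1.
Proof.
have fl' := fl.
have eg : eps g = 1.
  rewrite /g (sw_lin _ _ (G := eps)); last by lin.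
  transitivity (sw (fun x y => (eps x : K) *: f y) L).
    by apply: eq_sw => x y; rewrite linearZ [LHS]mulrC.
  by rewrite (sw_counitl _ fl') right_intL.
have := sw_antipoder g (@lin_id _ H); rewrite sw_dist_glike; [|by lin..].
by rewrite eg scale1r.
Qed.

(** Since g^k is grouplike, [right_int_int] reads f (g^k) g^k = f (g^k) 1: either f (g^k) = 0 or g^k
    = 1. *)
Lemma right_int_glike k : f 1 = 0 -> f (g ^+ k) = 0.
Proof.
have fl' := fl; move=> f1.
have swg : forall (B : H -> H -> H), (forall b, lin (B^~ b)) ->
   (forall a, lin (B a)) -> sw B (g ^+ k) = B (g ^+ k) (g ^+ k).
  elim: k => [|k IH] B Bl Br; first by rewrite sw1.
  by rewrite exprS swM // (sw_dist_glike (B := fun a b => _)) ?IH //; lin.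
have := right_int_int SK SiK (g ^+ k); rewrite swg; [|by lin..].
move/eqP; rewrite -subr_eq0 -scalerBr scaler_eq0 => /orP[/eqP //|].
by rewrite subr_eq0 => /eqP ->.
Qed.

Lemma right_int1_glike : f 1 <> 0 -> g = 1.
Proof.
have fl' := fl; move=> /eqP f1; have := right_int_left 1; rewrite sw1; [|by lin..].
by move=> /(scalerI f1).
Qed.

Definition drinfeld : H := sw (fun x y => S y * x) L.
Local Notation U := drinfeld.

Lemma drinfeldM a : U * a = S (S a) * U.
Proof.
transitivity (sw (fun x y => S y * (x * a)) L).
  rewrite /U (sw_lin _ _ (G := fun z => z * a)); last by lin.
  by apply: eq_sw => x y; rewrite mulrA.
rewrite (int_mulr Lint (B := fun x y => S y * x)); [|by lin..].
rewrite /U (sw_lin _ _ (G := fun z => S (S a) * z)); last by lin.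
by apply: eq_sw => x y; rewrite antipodeM mulrA.
Qed.

Lemma ltr_mull a : ltr (fun y : H => a * y) = f (a * U).
Proof.
have fl' := fl; rewrite ltr_right_int; last by lin.
rewrite /U (sw_lin _ _ (G := fun z => f (a * z))); last by lin.
by apply: eq_bigr => i _; rewrite mulrA.
Qed.

End FrobeniusForm.

(** * Semisimple algebras and their regular trace *)

Section EigenTrace.
Variables (K : closedFieldType) (V : vectType K) (F : V -> V).
Hypothesis Fl : lin F.

Lemma ltr_nilp k : (forall v, iter k F v = 0) -> ltr F = 0.
Proof.
move=> Fk; have [s [_ -> sP]] := ltr_eigen Fl; apply: big1_seq => a /= /sP[v v0 Fv].
have : iter k F v = a ^+ k *: v.
  elim: k {Fk} => [|k IH]; first by rewrite scale1r.
  by rewrite iterS IH (linZ Fl) Fv scalerA exprSr.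
by rewrite Fk => /esym/eqP; rewrite scaler_eq0 (negPf v0) orbF expf_eq0 => /andP[_ /eqP].
Qed.

Lemma ltr_idem : (forall v, F (F v) = F v) ->
  exists2 m : nat, (m <= \dim {:V})%N /\ ltr F = m%:R & forall v, F v <> 0 -> (0 < m)%N.
Proof.
move=> FF; have [s [szs -> sP]] := ltr_eigen Fl.
exists (count_mem 1 s); last first.
  move=> v Fv; rewrite -has_count has_pred1; apply/sP.
  by exists (F v); [apply/eqP | rewrite FF scale1r].
split; first by rewrite -szs count_size.
have s01 a : a \in s -> a = 0 \/ a = 1.
  move=> /sP[v v0 Fv]; have := FF v; rewrite Fv (linZ Fl) Fv => /eqP.
  rewrite -subr_eq0 -scalerBr scaler_eq0 => /orP[/eqP|]; first by left.
  by rewrite -{2}[v]scale1r -scalerBl scaler_eq0 (negPf v0) orbF subr_eq0 => /eqP; right.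
elim: s s01 {szs sP} => [|a s IH] s01; first by rewrite big_nil.
rewrite big_cons IH => [|b bs]; last by apply: s01; rewrite inE bs orbT.
rewrite /= natrD; congr (_ + _).
by case: (s01 a (mem_head _ _)) => ->; rewrite ?eqxx // eq_sym oner_eq0.
Qed.

Lemma ltr_signed c : (forall a v, v != 0 -> F v = a *: v -> a \in [:: 0; c; - c]) ->
  exists z : int, ltr F = c * z%:~R.
Proof.
move=> Fc; have [s [_ -> sP]] := ltr_eigen Fl.
have {}sP a : a \in s -> a \in [:: 0; c; - c] by move=> /sP[v v0 /(Fc _ _ v0)].
elim: s sP => [|a s IH] sP; first by exists 0; rewrite big_nil mulr0.
have [z Ez] : exists z : int, \sum_(b <- s) b = c * z%:~R.
  by apply: IH => b bs; apply: sP; rewrite inE bs orbT.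
rewrite big_cons Ez; have := sP a (mem_head _ _); rewrite !inE => /or3P[]/eqP->.
- by exists z; rewrite add0r.
- by exists (1 + z); rewrite intrD mulrDr mulr1.
- by exists (- 1 + z); rewrite intrD mulrDr mulrN mulr1.
Qed.
End EigenTrace.

Section Adjoint.
Variables (K : fieldType) (V : vectType K) (B : V -> V -> K^o).
Hypotheses (Bl : forall y, lin (B^~ y)) (Br : forall x, lin (B x)).
Hypothesis Bnd : forall y, (forall x, B x y = 0) -> y = 0.

Lemma form_dual (p : V -> K^o) : lin p -> exists y, forall x, p x = B x y.
Proof.
move=> pl; pose D := linfun (fun y => linfun (B^~ y) : 'Hom(V, K^o)).
have DE y : D y = linfun (B^~ y).
  apply: linfunE => a u v; apply/lfunP => x.
  by rewrite add_lfunE scale_lfunE !linfunE // Br.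
have D0 : lker D == 0%VS.
  rewrite -subv0; apply/subvP => y; rewrite memv_ker memv0 => /eqP Dy.
  by apply/eqP/Bnd => x; rewrite -(linfunE (Bl y)) -DE Dy zero_lfunE.
have Dim : limg D = fullv.
  apply/eqP; rewrite eqEdim subvf /=.
  have := limg_ker_dim D fullv; rewrite (eqP D0) capv0 dimv0 add0n !dimvf => ->.
  by rewrite -[dim 'Hom(V, K^o)]/(dim V * 1)%N muln1.
have : linfun p \in limg D by rewrite Dim memvf.
by move=> /memv_imgP[y _ py]; exists y => x; rewrite -(linfunE pl) py DE linfunE.
Qed.

Lemma ltr_adjoint (F G : V -> V) : lin F -> lin G ->
  (forall x y, B (F x) y = B x (G y)) -> ltr F = ltr G.
Proof.
move=> Fl Gl FG; pose b (i : 'I_(\dim {:V})) := (vbasis {:V})`_i.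
have /fin_all_exists[u uP] (i : 'I_(\dim {:V})) :
    exists y, forall x, coord (vbasis {:V}) i x = B x y.
  by apply: (form_dual (p := coord (vbasis {:V}) i)); lin.
rewrite [RHS](ltr_dual (u := u) (p := fun i y => B (b i) y)) //.
  by apply: eq_bigr => i _; rewrite uP FG.
move=> y; apply/eqP; rewrite -subr_eq0; apply/eqP/Bnd => x.
rewrite (linB (Br x)) (lin_sumE (Br x)).
rewrite -(lin_coordE (X := B^~ y) x) //.
rewrite -sumrB big1 // => i _; rewrite (linZ (Br x)) -uP.
by rewrite -/(b i) [X in X - _]mulrC subrr.
Qed.
End Adjoint.

Section RegularTrace.
Variables (K : closedFieldType) (A : falgType K).
Hypothesis charK : [pchar K] =i pred0.

Definition rtr (a : A) : K^o := ltr (fun y : A => a * y).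

Lemma rtr_lin : lin rtr.
Proof. by apply: ltr_lin; lin. Qed.

Lemma rtrC a b : rtr (a * b) = rtr (b * a).
Proof.
have al : lin (fun y => a * y) by lin.
have bl : lin (fun y => b * y) by lin.
transitivity (ltr ((fun y => a * y) \o (fun y => b * y))).
  by refine (@eq_ltr K A _ _ _) => y /=; rewrite mulrA.
by rewrite (ltr_comm al bl); refine (@eq_ltr K A _ _ _) => y /=; rewrite mulrA.
Qed.

Lemma rtr_nilp a k : a ^+ k = 0 -> rtr a = 0.
Proof.
move=> ak; have al : lin (fun y => a * y) by lin.
apply: (ltr_nilp al (k := k)) => v.
suff -> : iter k (fun y => a * y) v = a ^+ k * v by rewrite ak mul0r.
by elim: k {ak} => [|k IH]; rewrite ?mul1r // iterS IH exprS mulrA.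
Qed.

Lemma rtr_idem a : a * a = a -> exists2 m : nat, rtr a = m%:R & a <> 0 -> (0 < m)%N.
Proof.
move=> aa; have al : lin (fun y => a * y) by lin.
have [v|m [_ Em] m0] := ltr_idem al; first by rewrite mulrA aa.
by exists m => // a0; apply: (m0 1); rewrite mulr1.
Qed.

(** The radical of the trace form is a two-sided ideal; its right unit e is an idempotent of trace
    0, hence e = 0 in characteristic zero. *)
Lemma rtr_nondeg a : semisimple_algebra A -> (forall b, rtr (a * b) = 0) -> a = 0.
Proof.
have rl := rtr_lin; move=> ssA a0.
pose D := linfun (fun a => linfun (fun b => rtr (a * b)) : 'Hom(A, K^o)).
have DE x b : D x b = rtr (x * b).
  rewrite /D linfunE ?linfunE //; first by lin.
  move=> c u v; apply/lfunP => y; rewrite add_lfunE scale_lfunE !linfunE; [|by lin..].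
  by rewrite mulrDl -scalerAl rl.
have IP x : reflect (forall b, rtr (x * b) = 0) (x \in lker D).
  rewrite memv_ker; apply: (iffP eqP) => [Dx b|x0].
    by rewrite -DE Dx zero_lfunE.
  by apply/lfunP => b; rewrite DE x0 zero_lfunE.
have [c x /IP x0|c x /IP x0|e eI eK] := ideal_unit (I := lker D) ssA.
- by apply/IP => b; rewrite rtrC mulrA rtrC.
- by apply/IP => b; rewrite -mulrA.
have [m Em m0] := rtr_idem (eK _ eI).
have e0 : e = 0.
  apply/eqP/negPn/negP => /eqP /m0; rewrite lt0n -((pcharf0P K).1 charK) -Em.
  by have /IP/(_ 1) := eI; rewrite mulr1 => ->; rewrite eqxx.
by rewrite -(eK a) ?e0 ?mulr0 //; apply/IP.
Qed.

(** Right and left multiplication by a are adjoint for the trace form. *)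
Lemma ltr_mulr a : semisimple_algebra A -> ltr (fun y : A => y * a) = rtr a.
Proof.
have rl := rtr_lin; move=> ssA.
apply: (ltr_adjoint (B := fun x y => rtr (x * y))); try by lin.
  move=> y y0; apply: rtr_nondeg => // x; by rewrite rtrC.
by move=> x y; rewrite mulrA.
Qed.
End RegularTrace.

Lemma natr_inj0 (K : fieldType) : [pchar K] =i pred0 ->
  injective (fun n : nat => n%:R : K).
Proof.
move=> /pcharf0P cK; have H m n : (m <= n)%N -> m%:R = n%:R :> K -> m = n.
  move=> mn /eqP; rewrite eq_sym -subr_eq0 -natrB // cK subn_eq0 => nm.
  by apply/eqP; rewrite eqn_leq mn.
by move=> m n; case/orP: (leq_total m n) => /H mn E; [apply: mn | apply/esym/mn].
Qed.

(** * Idempotent decompositions inside a commutative subalgebra *)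

Section CommutativeDecomposition.
Variables (K : closedFieldType) (A : falgType K) (B : A -> Prop).
Hypothesis charK : [pchar K] =i pred0.
Hypotheses (B1 : B 1) (BD : forall x y, B x -> B y -> B (x + y)).
Hypotheses (BZ : forall c x, B x -> B (c *: x)).
Hypotheses (BM : forall x y, B x -> B y -> B (x * y)).
Hypothesis BC : forall x y, B x -> B y -> x * y = y * x.

Lemma annihilating_poly (b : A) : exists2 p : {poly K}, p != 0 & horner_alg b p = 0.
Proof.
pose n := (\dim {:A}).+1; pose X := [tuple b ^+ i | i < n].
have nX : ~~ free X.
  apply/negP => /eqnP fX; have := dimvS (subvf <<X>>%VS).
  by rewrite fX size_tuple ltnn.
apply: NNPP => np; case/negP: nX; apply/freeP => k kX i.
pose p := \sum_(i < n) k i *: 'X^i : {poly K}.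
have -> : k i = p`_i.
  rewrite coef_sum (bigD1 i) //= coefZ coefXn eqxx mulr1 big1 ?addr0 // => j ji.
  by rewrite coefZ coefXn eq_sym (inj_eq val_inj) (negPf ji) mulr0.
suff -> : p = 0 by rewrite coef0.
apply/eqP/negPn/negP => p0; apply: np; exists p => //.
rewrite -[RHS]kX rmorph_sum; apply: eq_bigr => j _ /=.
rewrite -mul_polyC rmorphM rmorphXn /= horner_algC horner_algX -scalerAl mul1r.
by rewrite nth_mktuple.
Qed.

Lemma horner_alg_closed b p : B b -> B (horner_alg b p).
Proof.
move=> Bb; elim/poly_ind: p => [|p c IH].
  by rewrite rmorph0 -(scale0r 1); apply: BZ.
rewrite rmorphD rmorphM /= horner_algX horner_algC.
by apply: BD; [apply: BM | apply: BZ].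
Qed.

(** Take p with p (b) e = 0 and a root beta, so that p = q r with r = (X - beta)^m and q (beta) <>
    0. A Bezout relation u q + v r = 1 splits e, and the part e1 = (u q) (b) e is killed by r
    (b). *)
Lemma spectral_idem e b : B e -> e * e = e -> e != 0 -> B b ->
  exists (beta : K) e1 k, [/\ B e1, e1 * e1 = e1, e1 != 0, e1 * e = e1
    & (b - beta%:A) ^+ k * e1 = 0].
Proof.
move=> Be ee e0 Bb; have Bh p := horner_alg_closed p Bb.
have [p p0 /(congr1 ( *%R^~ e))] := annihilating_poly b; rewrite mul0r.
have [n le_p_n] := ubnP (size p); elim: n => // n IH in p p0 le_p_n * => pe0.
have [/size_poly1P[c c0 pc]|] := boolP (size p == 1%N).
  move/eqP: pe0; rewrite pc horner_algC -scalerAl mul1r scaler_eq0.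
  by rewrite (negPf c0) (negPf e0).
move=> /closed_rootP[beta rp].
have [m [q qb pq]] := multiplicity_XsubC p beta.
rewrite p0 /= in qb.
have cop : coprimep q (('X - beta%:P) ^+ m).
  by apply: coprimep_expr; rewrite coprimep_XsubC.
have /Bezout_eq1_coprimepP[[u v] /= uv] := cop.
set r := ('X - beta%:P) ^+ m in cop pq uv.
have hr : horner_alg b r = (b - beta%:A) ^+ m.
  by rewrite rmorphXn rmorphB /= horner_algX horner_algC.
pose e1 := horner_alg b (u * q) * e; pose e2 := horner_alg b (v * r) * e.
have e12 : e1 + e2 = e by rewrite -mulrDl -rmorphD /= uv rmorph1 mul1r.
have kill s : horner_alg b (s * (q * r)) * e = 0.
  by rewrite -pq rmorphM /= -mulrA pe0 mulr0.
have e1e : e1 * e = e1 by rewrite -mulrA ee.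
have [e10|e10] := eqVneq e1 0; last first.
  exists beta, e1, m; split=> //; first by apply: BM.
    rewrite -[in RHS]e1e -e12 mulrDr [X in _ + X](_ : _ = 0) ?addr0 //.
    by rewrite /e1 /e2 -mulrA (mulrA e) (BC Be (Bh _)) -mulrA ee mulrA -rmorphM /= mulrACA kill.
  by rewrite -hr mulrA -rmorphM /= mulrCA (mulrC r) kill.
(* Here e1 = 0, so e = e2 is already killed by q (b), and q has smaller degree. *)
apply: (IH q).
- by apply: contraNneq p0 => q0; rewrite pq q0 mul0r.
- have q0 : q != 0 by apply: contraNneq p0 => q0; rewrite pq q0 mul0r.
  move: le_p_n; rewrite {1}pq size_Mmonic ?monic_exp ?monicXsubC // size_exp_XsubC.
  have : (0 < m)%N.
    by case: (m) @r pq rp {cop uv hr e2 e12 kill} => // r; rewrite /r expr0 mulr1 => ->; rewrite (negPf qb).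
  by rewrite addnS /= !ltnS => m0; apply: leq_trans; rewrite -[X in (X < _)%N]addn0 ltn_add2l.
- by rewrite -{1}e12 e10 add0r /e2 mulrA -rmorphM /= mulrCA kill.
Qed.

(** An idempotent on which some b in B has no single generalized eigenvalue is split by
    [spectral_idem]. Regular traces of nonzero idempotents are positive integers and add up, so this
    terminates. *)
Lemma comm_decomposition : exists es : seq A,
  (forall x, x \in es -> [/\ B x, x * x = x, x != 0
     & forall b, B b -> exists (beta : K) k, (b - beta%:A) ^+ k * x = 0])
  /\ \sum_(x <- es) x = 1.
Proof.
pose good x := [/\ B x, x * x = x, x != 0
     & forall b, B b -> exists (beta : K) k, (b - beta%:A) ^+ k * x = 0].
suff main e : B e -> e * e = e -> e != 0 -> exists es : seq A,
    (forall x, x \in es -> good x) /\ \sum_(x <- es) x = e.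
  by apply: main; rewrite ?mulr1 ?oner_neq0.
move=> Be ee e0; have [m Em _] := rtr_idem ee.
have [n le_m_n] := ubnP m; elim: n => // n IH in m e Be ee e0 Em le_m_n *.
have [ge|nge] := classic (good e).
  by exists [:: e]; split=> [x|]; rewrite ?big_seq1 // inE => /eqP->.
have [b Bb bad] : exists2 b, B b & forall beta k, (b - beta%:A) ^+ k * e <> 0.
  apply: NNPP => nb; apply: nge; split=> // b Bb; apply: NNPP => nbk.
  by apply: nb; exists b => // beta k bk; apply: nbk; exists beta, k.
have [beta [e1 [k [Be1 e11 e10 e1e be1]]]] := spectral_idem Be ee e0 Bb.
pose e2 := e - e1.
have ee1 : e * e1 = e1 by rewrite BC.
have Be2 : B e2 by apply: BD => //; rewrite -scaleN1r; apply: BZ.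
have e22 : e2 * e2 = e2.
  by rewrite mulrBr !mulrBl ee e1e ee1 e11 subrr subr0.
have e20 : e2 != 0.
  by apply/eqP => /subr0_eq E; apply: (bad beta k); rewrite E.
have [m1 Em1 /(_ (elimN eqP e10)) m1_gt0] := rtr_idem e11.
have [m2 Em2 /(_ (elimN eqP e20)) m2_gt0] := rtr_idem e22.
have Dm : m = (m1 + m2)%N.
  have : rtr e = (m1 + m2)%:R.
    by rewrite natrD -Em1 -Em2 -(linD (@rtr_lin _ _)) addrC subrK.
  by rewrite Em => /(natr_inj0 charK).
rewrite Dm ltnS in le_m_n.
have [es1 [g1 s1]] : exists es : seq A, (forall x, x \in es -> good x) /\ \sum_(x <- es) x = e1.
  by apply: (IH m1) => //; apply: leq_trans le_m_n; rewrite -addn1 leq_add2l.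
have [es2 [g2 s2]] : exists es : seq A, (forall x, x \in es -> good x) /\ \sum_(x <- es) x = e2.
  by apply: (IH m2) => //; apply: leq_trans le_m_n; rewrite -add1n leq_add2r.
exists (es1 ++ es2); split; last by rewrite big_cat s1 s2 /= addrC subrK.
by move=> x; rewrite mem_cat => /orP[/g1|/g2].
Qed.
End CommutativeDecomposition.

(** * The square of the antipode *)

Section RationalGram.
Import Order.TTheory Num.Theory.

(** If C annihilates the Gram matrix from the right, the diagonal of (D C)^T W (D C) vanishes; its
    entries are sums of squares with positive weights, so D C = 0. Taking the cokernel for C gives
    the inclusion. *)
Lemma gram_rowspace (F : realFieldType) r q (D : 'M[F]_(r, q)) (w : 'rV[F]_r) :
  (forall i, 0 < w 0 i) -> (D <= D^T *m diag_mx w *m D)%MS.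
Proof.
move=> w0; rewrite submxE.
have: D^T *m diag_mx w *m D *m cokermx (D^T *m diag_mx w *m D) = 0.
  exact: mulmx_coker.
move: (cokermx _) => C.
move=> /(congr1 (mulmx C^T)); rewrite mulmx0 !mulmxA -trmx_mul -mulmxA.
move=> /matrixP E; apply/eqP/matrixP => i j; move: (E j j); rewrite mxE.
have E1 k : ((D *m C)^T *m diag_mx w) j k * (D *m C) k j
    = (D *m C) k j * w 0 k * (D *m C) k j by congr (_ * _); rewrite mul_mx_diag !mxE.
under eq_bigr => k _ do rewrite E1.
rewrite [RHS]mxE => E0; rewrite [RHS]mxE.
have /psumr_eq0P : forall k, true -> 0 <= (D *m C) k j * w 0 k * (D *m C) k j.
  by move=> k _; rewrite mulrAC -expr2 mulr_ge0 ?sqr_ge0 // ltW.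
move=> /(_ _)/(_ i isT) H.
have /eqP : (D *m C) i j * w 0 i * (D *m C) i j = 0.
  by apply: H.
by rewrite mulrAC mulf_eq0 (gt_eqF (w0 i)) orbF -expr2 expf_eq0 => /eqP.
Qed.

Lemma common_denominator r q (M : 'M[rat]_(r, q)) :
  exists (N : int) (M' : 'M[int]_(r, q)), N != 0 /\ map_mx intr M' = N%:~R *: M.
Proof.
pose d (ij : 'I_r * 'I_q) := denq (M ij.1 ij.2).
exists (\prod_ij d ij).
exists (\matrix_(i, j) (numq (M i j) * \prod_(ij | ij != (i, j)) d ij)).
split; first by apply/prodf_neq0 => ij _; apply: denq_neq0.
apply/matrixP => i j; rewrite !mxE [\prod_ij d ij](bigD1 (i, j)) //= !intrM.
by rewrite [RHS]mulrAC; congr (_ * _); rewrite /d /= mulrC -numqE.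
Qed.

(* Over the rationals, [D beta = N y] and [D^T y = 0] force
   [D^T N^-1 D beta = 0], hence [D beta = 0] by positivity; the row-space
   inclusion of [gram_rowspace] transports this conclusion to K. *)
Lemma gram_kernel (K : fieldType) (charK : [pchar K] =i pred0) r q
    (D : 'M[int]_(r, q)) (n : 'I_r -> nat) (beta : 'I_q -> K) (y : 'I_r -> K) :
  (forall i, (0 < n i)%N) ->
  (forall i, \sum_k beta k * (D i k)%:~R = (n i)%:R * y i) ->
  (forall k, \sum_i y i * (D i k)%:~R = 0) -> forall i, y i = 0.
Proof.
move=> n0 Dbeta Dy.
(* These weights are the inverses of the n_i, multiplied by the product of all n_j to stay
   integral. *)
pose w : 'rV[int]_r := \row_i (\prod_(j | j != i) n j)%N%:Z.
pose A := D^T *m diag_mx w *m D.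
have natK0 m : (0 < m)%N -> m%:R != 0 :> K.
  by move=> m0; rewrite ((pcharf0P K).1 charK) -lt0n.
have intK0 (z : int) : z != 0 -> z%:~R != 0 :> K.
  by case: z => m; rewrite ?NegzE ?rmorphN ?oppr_eq0 /= => m0; apply: natK0; rewrite // lt0n.
have [N [X [N0 NX]]] : exists (N : int) (X : 'M[int]_(r, q)), N != 0 /\ N *: D = X *m A.
  have /submxP[X0 DX0] : (map_mx (intr : int -> rat) D <= map_mx (intr : int -> rat) A)%MS.
    rewrite !map_mxM -map_trmx map_diag_mx; apply: gram_rowspace => i.
    by rewrite !mxE /= ltr0n prodn_gt0.
  have [N [X [N0 NX]]] := common_denominator X0; exists N, X; split=> //.
  apply/matrixP => i j; apply: (@intr_inj rat).
  suff /matrixP/(_ i j) : map_mx (intr : int -> rat) (N *: D) = map_mx intr (X *m A).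
    by rewrite ![map_mx _ _ i j]mxE.
  by rewrite map_mxZ map_mxM NX -scalemxAl DX0.
pose b : 'cV[K]_q := \col_k beta k.
have Db : map_mx intr D *m b = \col_i ((n i)%:R * y i).
  apply/colP => i; rewrite !mxE -Dbeta.
  by apply: eq_bigr => k _; rewrite !mxE mulrC.
have Ab : map_mx intr A *m b = 0.
  rewrite !map_mxM -map_trmx map_diag_mx -!mulmxA Db.
  apply/colP => k; rewrite !mxE.
  transitivity (\sum_i (\prod_j n j)%N%:R * (y i * (D i k)%:~R)).
    apply: eq_bigr => i _; rewrite mul_diag_mx !mxE /=.
    rewrite [in RHS](bigD1 i) //= natrM.
    by rewrite mulrC (mulrCA _ (n i)%:R) !mulrA.
  by rewrite -mulr_sumr Dy mulr0.
move=> i; have /(congr1 (fun M => map_mx (intr : int -> K) M *m b)) := NX.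
rewrite map_mxZ map_mxM -mulmxA Ab mulmx0 -scalemxAl Db => /matrixP/(_ i 0).
rewrite !mxE => /eqP; rewrite mulf_eq0 (negPf (intK0 _ N0)) mulf_eq0.
by rewrite (negPf (natK0 _ (n0 i))) => /eqP.
Qed.
End RationalGram.

(** * Nonvanishing of f at 1 *)

Section NonVanishing.
Variables (K : closedFieldType) (H : hopfAlgType K) (Si : H -> H) (L : H).
Local Notation eps := (counit : H -> K^o).
Local Notation S := (antipode : H -> H).
Hypotheses (charK : [pchar K] =i pred0) (ssH : semisimple_algebra H).
Hypotheses (SK : cancel S Si) (SiK : cancel Si S).
Hypotheses (Lint : two_sided_integral L) (eL : eps L = 1).
Local Notation f := (right_int Si).
Local Notation g := (dist_glike Si L).
Local Notation U := (drinfeld L).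
Local Notation fl := (right_int_lin SK SiK).

Lemma rtr_right_int a : rtr a = f (a * U).
Proof. exact: (ltr_mull SK SiK Lint eL). Qed.

(** If a U = 0 then rtr (b a) = f (b a U) = 0 for all b, so a = 0 by nondegeneracy: right
    multiplication by U is injective, hence bijective. *)
Lemma drinfeld_inv : exists Ui, U * Ui = 1 /\ Ui * U = 1.
Proof.
pose F := linfun (fun a => a * U) : 'End(H).
have FE a : F a = a * U by rewrite linfunE //; lin.
have F0 : lker F == 0%VS.
  rewrite -subv0; apply/subvP => a; rewrite memv_ker memv0 FE => /eqP aU.
  apply/eqP/(rtr_nondeg charK ssH) => b.
  by rewrite rtrC rtr_right_int -mulrA aU mulr0 (lin0 fl).
exists (F^-1%VF 1).
have UiU : F^-1%VF 1 * U = 1 by rewrite -FE lker0_lfunVK.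
split=> //; have /lker0P Finj := F0; apply: Finj.
by rewrite !FE -mulrA UiU mulr1 mul1r.
Qed.

Lemma dist_glike_invl : S g * g = 1.
Proof.
have fl' := fl.
have gg := sw_dist_glike SK SiK Lint eL.
have gS := dist_glike_inv SK SiK Lint eL.
have eg : (eps g : K) *: (1 : H) = 1.
  by have := sw_antipoder g (@lin_id _ H); rewrite gg; [rewrite gS => <- | lin..].
by have := sw_antipodel g (@lin_id _ H); rewrite gg; [rewrite eg | lin..].
Qed.

(** As S^-2 is conjugation by U^-1, f (U x) is the trace of y |-> x y U = y U x, which is rtr (U x)
    by [ltr_mulr]; and f (U x) = f (x U) = rtr (x). *)
Lemma rtr_drinfeld x : (forall a, x * a = a * x) -> rtr (U * x) = rtr x.
Proof.
move=> xC; have [Ui [UUi UiU]] := drinfeld_inv.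
rewrite [RHS]rtr_right_int xC.
have -> : f (U * x) = ltr (fun y : H => y * (U * x)).
  refine (@eq_ltr K H _ _ _) => y /=.
  have SSE z : Si (Si z) = Ui * z * U.
    by rewrite -[z in RHS]SiK -[Si z in RHS]SiK -mulrA -drinfeldM // mulrA UiU mul1r.
  by rewrite SSE !mulrA UiU mul1r xC -mulrA xC mulrA.
by rewrite (ltr_mulr charK _ ssH).
Qed.

Lemma right_int1_neq0 : f 1 <> 0.
Proof.
have fl' := fl; move=> f1.
have [Ui [UUi UiU]] := drinfeld_inv.
have gS := dist_glike_inv SK SiK Lint eL; have Sg := dist_glike_invl.
have SSg : S (S g) = g.
  have := congr1 S gS; rewrite antipodeM antipode1 => E.
  by rewrite -[LHS]mulr1 -Sg mulrA E mul1r.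
have Ug : U * g = g * U by rewrite (drinfeldM Lint) SSg.
(* Both g and U^2 implement S^4 by conjugation, so z = U^2 g^-1 is central. *)
pose z := U * U * S g.
have USg : U * S g = S g * U.
  by rewrite -[LHS]mul1r -Sg -!mulrA (mulrA g) -Ug -(mulrA U) gS mulr1.
have UUz : U * U = z * g by rewrite /z -mulrA Sg mulr1.
have zC a : z * a = a * z.
  have SgC : S g * S (S (S (S a))) = a * S g.
    rewrite -[LHS]mulr1 -gS mulrA -(mulrA (S g)) (SSSS_dist_glike SK SiK Lint).
    by rewrite !mulrA Sg mul1r.
  have zE : z = S g * U * U by rewrite /z -mulrA USg mulrA USg.
  rewrite [in LHS]zE -mulrA (drinfeldM Lint) mulrA -(mulrA (S g)) (drinfeldM Lint).
  by rewrite mulrA SgC -!mulrA (mulrA (S g)) -zE.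
pose zi := g * Ui * Ui.
have zzi : z * zi = 1.
  by rewrite /z /zi !mulrA -(mulrA (U * U)) Sg mulr1 -(mulrA U) UUi mulr1 UUi.
have ziz : zi * z = 1 by rewrite -zC.
have ziC a : zi * a = a * zi.
  by rewrite -[LHS]mulr1 -zzi mulrA -(mulrA zi) -zC (mulrA zi) ziz mul1r.
have gUi : g * Ui = zi * U.
  by rewrite -[LHS]mul1r -ziz -mulrA (mulrA z) -UUz -!mulrA UUi mulr1.
clearbody z zi.
pose C x := forall a : H, x * a = a * x.
(* The central idempotents [es] separate the blocks of H; below, the idempotents [ps] of K[g]
   separate the eigenvalues of g. *)
have [es [esP es1]] : exists es : seq H,
  (forall x, x \in es -> [/\ C x, x * x = x, x != 0
     & forall b, C b -> exists (beta : K) k, (b - beta%:A) ^+ k * x = 0])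
  /\ \sum_(x <- es) x = 1.
  apply: comm_decomposition => //.
  - by move=> a; rewrite mul1r mulr1.
  - by move=> x y xC yC a; rewrite mulrDl mulrDr xC yC.
  - by move=> c x xC a; rewrite -scalerAl -scalerAr xC.
  - by move=> x y xC yC a; rewrite -mulrA yC !mulrA xC.
pose G x := exists p, x = horner_alg g p.
have GU x : G x -> U * x = x * U.
  move=> [p ->]; elim/poly_ind: p => [|p c IH]; first by rewrite rmorph0 mulr0 mul0r.
  rewrite rmorphD rmorphM /= horner_algX horner_algC mulrDr mulrDl mulrA IH.
  by rewrite -!mulrA Ug -scalerAl -scalerAr mulr1 mul1r.
have fG x : G x -> f (g * x) = 0.
  move=> [p ->]; suff H0 k : f (g ^+ k * horner_alg g p) = 0 by apply: (H0 1%N).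
  elim/poly_ind: p k => [|p c IH] k; first by rewrite rmorph0 mulr0 (lin0 fl).
  rewrite rmorphD rmorphM /= horner_algX horner_algC mulrDr (linD fl).
  rewrite -scalerAr mulr1 (linZ fl) (right_int_glike SK SiK Lint eL) // scaler0 addr0.
  have -> : horner_alg g p * g = g * horner_alg g p.
    by have := congr1 (horner_alg g) (mulrC p 'X); rewrite !rmorphM /= horner_algX.
  by rewrite mulrA -exprSr IH.
have [ps [psP ps1]] : exists ps : seq H,
  (forall x, x \in ps -> [/\ G x, x * x = x, x != 0
     & forall b, G b -> exists (beta : K) k, (b - beta%:A) ^+ k * x = 0])
  /\ \sum_(x <- ps) x = 1.
  apply: comm_decomposition => //.
  - by exists 1; rewrite rmorph1.
  - by move=> x y [p ->] [q ->]; exists (p + q); rewrite rmorphD.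
  - by move=> c x [p ->]; exists (c *: p); rewrite -mul_polyC rmorphM /= horner_algC -scalerAl mul1r.
  - by move=> x y [p ->] [q ->]; exists (p * q); rewrite rmorphM.
  - by move=> x y [p ->] [q ->]; rewrite -!rmorphM mulrC.
have sqrtK (x : K) : exists y, y ^+ 2 = x.
  have /closed_rootP[y] : size ('X^2 - x%:P) != 1%N by rewrite size_XnsubC.
  by rewrite rootE !hornerE subr_eq0 => /eqP; exists y.
(* On a block x, c = b - beta is central with c x nilpotent, so every c x a is nilpotent and has
   trace 0; nondegeneracy gives c x = 0. *)
have scalE b x : x \in es -> C b -> exists beta : K, b * x = beta *: x.
  move=> /esP[xC xx x0 xs] bC; have [beta [k bk]] := xs b bC; exists beta.
  set c := b - beta%:A in bk.
  have cC a : c * a = a * c.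
    by rewrite mulrBl mulrBr bC -scalerAl -scalerAr mul1r mulr1.
  suff cx : c * x = 0.
    by move/eqP: cx; rewrite mulrBl -scalerAl mul1r subr_eq0 => /eqP.
  apply: (rtr_nondeg charK ssH) => a; apply: (@rtr_nilp _ _ _ k.+1).
  have comm1 : GRing.comm (c * x) a by rewrite /GRing.comm mulrA -cC -!mulrA xC.
  have comm2 : GRing.comm c x by rewrite /GRing.comm cC.
  rewrite (exprMn_comm _ comm1) (exprMn_comm _ comm2) exprS -mulrA.
  have -> : x ^+ k.+1 = x by elim: (k) => // k' IH; rewrite exprS IH.
  by rewrite -!mulrA (mulrA _ x) bk mul0r mulr0.
pose E (i : 'I_(size es)) := es`_i; pose P (k : 'I_(size ps)) := ps`_k.
(* Square roots are taken of the eigenvalues of z and of g because U^2 = z g: on P_k E_i the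
   eigenvalues of U are then zeta_i beta_k up to sign. *)
have /fin_all_exists[zeta zetaP] i : exists s : K, s != 0 /\ z * E i = s ^+ 2 *: E i.
  have Ei : E i \in es by apply: mem_nth.
  have [b bE] := scalE z _ Ei zC; have [s sb] := sqrtK b; exists s.
  rewrite sb; split=> //; apply/eqP => s0; have [_ _ /eqP[]] := esP _ Ei.
  by rewrite -[LHS]mul1r -ziz -mulrA bE -sb s0 expr0n scale0r mulr0.
have /fin_all_exists[n nP] i : exists m : nat, rtr (E i) = m%:R /\ (0 < m)%N.
  have [_ xx /eqP x0 _] := esP _ (mem_nth 0 (ltn_ord i)).
  by have [m Em /(_ x0) m0] := rtr_idem xx; exists m.
have /fin_all_exists[beta betaP] k :
    exists b : K, b != 0 /\ exists m, (g - (b ^+ 2)%:A) ^+ m * P k = 0.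
  have [_ xx x0 xs] := psP _ (mem_nth 0 (ltn_ord k)).
  have [c [m cm]] := xs g (ex_intro _ 'X (esym (horner_algX g))).
  have [b bc] := sqrtK c; exists b; rewrite bc; split; last by exists m.
  apply/eqP => b0; case/eqP: x0; move: cm; rewrite -bc b0 expr0n scale0r subr0.
  move=> /(congr1 ( *%R (S g ^+ m))); rewrite mulr0 mulrA.
  rewrite -(exprMn_comm m (_ : GRing.comm (S g) g)) ?Sg ?expr1n ?mul1r //.
  by rewrite /GRing.comm Sg gS.
have [PG PP] : (forall k, G (P k)) /\ (forall k, P k * P k = P k).
  by split=> k; have [] := psP _ (mem_nth 0 (ltn_ord k)).
have [EC EE] : (forall i, C (E i)) /\ (forall i, E i * E i = E i).
  by split=> k; have [] := esP _ (mem_nth 0 (ltn_ord k)).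
have /fin_all_exists[D DP] i : exists d : 'I_(size ps) -> int,
    forall k, rtr (U * P k * E i) = zeta i * beta k * (d k)%:~R.
  suff /fin_all_exists[d dP] k : exists d : int,
    rtr (U * P k * E i) = zeta i * beta k * d%:~R by exists d.
  refine (@ltr_signed K H (fun y => U * P k * E i * y) _ (zeta i * beta k) _); first by lin.
  (* For a nonzero eigenvalue a, the eigenvector v lies in the image of P_k E_i, where z acts as
     zeta_i^2; since U^2 = z g, v is an eigenvector of g with eigenvalue (a / zeta_i)^2, which must
     be beta_k^2. *)
  move=> a v v0; set X := U * P k * E i => Xv.
  have [->|a0] := eqVneq a 0; first by rewrite inE eqxx.
  have [zeta0 zE] := zetaP i; have [beta0 [m gP]] := betaP k.
  have PEX : P k * E i * X = X.
    rewrite /X mulrA -(mulrA _ (E i)) EC !mulrA -(GU _ (PG k)).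
    by rewrite -(mulrA U) PP -(mulrA _ (E i)) EE.
  have vX : v = a^-1 *: (X * v) by rewrite Xv scalerA mulVf // scale1r.
  have PEv : P k * E i * v = v by rewrite {1}vX -scalerAr mulrA PEX -vX.
  have Ev : E i * v = v by rewrite -{1}PEv mulrA (EC i (P k * E i)) -(mulrA (P k)) EE PEv.
  have XX : X * X = z * g * (P k * E i).
    have XE : X = P k * E i * U by rewrite /X (GU _ (PG k)) -!mulrA EC.
    rewrite -UUz {1}/X XE mulrA -(mulrA (U * P k)) (EC i (P k * E i)) -(mulrA (P k)) EE.
    rewrite -!mulrA (mulrA (P k) (P k)) PP (mulrA (P k)) -XE /X !mulrA.
    by [].
  have gv : zeta i ^+ 2 *: (g * v) = a ^+ 2 *: v.
    have -> : a ^+ 2 *: v = X * X * v by rewrite -mulrA Xv -scalerAr Xv scalerA.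
    have zv : z * v = zeta i ^+ 2 *: v by rewrite -{1}Ev mulrA zE -scalerAl Ev.
    by rewrite XX -mulrA PEv (zC g) -mulrA zv -scalerAr.
  have {}gv : g * v = ((a / zeta i) ^+ 2) *: v.
    by rewrite expr_div_n mulrC -scalerA -gv scalerA mulVf ?expf_neq0 // scale1r.
  have gm l : (g - (beta k ^+ 2)%:A) ^+ l * v = ((a / zeta i) ^+ 2 - beta k ^+ 2) ^+ l *: v.
    elim: l => [|l IH]; first by rewrite mul1r scale1r.
    rewrite exprSr -mulrA mulrBl gv -scalerAl mul1r -scalerBl -scalerAr IH scalerA.
    by rewrite -exprS.
  have := gm m; rewrite -{1}PEv !mulrA gP !mul0r => /esym/eqP.
  rewrite scaler_eq0 (negPf v0) orbF expf_eq0 => /andP[_].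
  rewrite subr_eq0 eqf_sqr => H2; rewrite !inE.
  have -> : a = zeta i * (a / zeta i) by rewrite mulrC divfK.
  by case/orP: H2 => /eqP->; rewrite ?mulrN eqxx !orbT.
have Esum x : x = \sum_i x * E i.
  by rewrite -mulr_sumr -[LHS]mulr1 -es1 (big_nth 0) big_mkord.
have Psum x : x = \sum_k x * P k.
  by rewrite -mulr_sumr -[LHS]mulr1 -ps1 (big_nth 0) big_mkord.
have rl := @rtr_lin K H.
(* The vector zeta_i^-1 will satisfy both systems of [gram_kernel], hence vanish, which is
   absurd. *)
have y0 := @gram_kernel K charK _ _ (\matrix_(i, k) D i k) n beta (fun i => (zeta i)^-1).
have r0 : (0 < size es)%N.
  rewrite lt0n; apply/eqP => /size0nil e0; move: es1; rewrite e0 big_nil.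
  by move/esym/eqP; rewrite oner_eq0.
have [zeta0 _] := zetaP (Ordinal r0).
suff /eqP : (zeta (Ordinal r0))^-1 = 0 by rewrite invr_eq0 (negPf zeta0).
apply: y0 => [i|i|k]; first by case: (nP i).
  (* Summed over k, rtr (U P_k E_i) is rtr (U E_i) = rtr (E_i) = n_i. *)
  have [z0 zE] := zetaP i; apply: (mulfI z0); rewrite mulrCA divff // mulr1.
  rewrite -(nP i).1 -(rtr_drinfeld (EC i)) (Psum U) mulr_suml (lin_sumE rl) mulr_sumr.
  by apply: eq_bigr => k _; rewrite DP mxE mulrA.
have [b0 _] := betaP k; apply: (mulfI b0); rewrite mulr0 mulr_sumr.
(* Since g U^-1 = z^-1 U, f (g P_k E_i) = rtr (g P_k E_i U^-1) = zeta_i^-2 rtr (U P_k E_i); the sum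
   over i is f (g P_k) = 0. *)
have fi i : beta k * ((zeta i)^-1 * (D i k)%:~R) = f (g * P k * E i).
  have [z0 zE] := zetaP i.
  have PUi : P k * Ui = Ui * P k.
    by rewrite -[LHS]mul1r -UiU -mulrA (mulrA U) (GU _ (PG k)) -mulrA UUi mulr1.
  have ziE : zi * E i = (zeta i ^+ 2)^-1 *: E i.
    by rewrite -{2}[E i]mul1r -ziz -mulrA zE -scalerAr scalerA mulVf ?expf_neq0 // scale1r.
  have -> : f (g * P k * E i) = rtr (g * P k * E i * Ui).
    by rewrite [RHS]rtr_right_int -(mulrA _ Ui) UiU mulr1.
  have -> : g * P k * E i * Ui = (zeta i ^+ 2)^-1 *: (U * P k * E i).
    rewrite -(mulrA (g * P k)) EC mulrA -(mulrA g) PUi mulrA gUi -!(mulrA zi).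
    by rewrite ziC -mulrA -(ziC (E i)) ziE -scalerAr.
  rewrite (linZ rl) DP [RHS]mulrA [LHS]mulrA; congr (_ * _).
  by rewrite expr2 invfM -mulrA mulKf // mulrC.
rewrite (eq_bigr (fun i => f (g * P k * E i))) => [|i _]; last by rewrite mxE fi.
by have := fG _ (PG k); rewrite {1}(Esum (g * P k)) (lin_sumE fl).
Qed.
End NonVanishing.

(** * The regular character of the dual *)

Section RegularElement.
Variables (K : fieldType) (H : hopfAlgType K).
Local Notation e := (vbasis {:H}).
Local Notation n := (\dim {:H}).
Local Notation eps := (counit : H -> K^o).
Local Notation S := (antipode : H -> H).

(* The character of the regular representation of the dual, seen in H. *)
Definition dual_reg : H := \sum_i cl i e`_i.
Local Notation x := dual_reg.

(** The transpose of left convolution by p: (p q) (h) = q ([hit p h]) for every form q. *)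
Definition hit (p : H -> K^o) (h : H) : H := sw (fun a b => (p a : K) *: b) h.

Lemma hit_lin p : lin p -> lin (hit p).
Proof. by move=> pl; rewrite /hit; lin. Qed.

Lemma coord_basis_delta (i j : 'I_n) : coord e i e`_j = (i == j)%:R.
Proof. by rewrite coord_free ?(basis_free (vbasisP _)) // eq_sym. Qed.

Lemma dual_reg_form p : lin p -> p x = ltr (hit p).
Proof.
move=> pl; rewrite /x (lin_sumE pl); apply: eq_bigr => i _.
rewrite /hit /sw linear_sum (bigD1 i) //= linearZ /= coord_basis_delta eqxx.
rewrite [_ * 1]mulr1 big1 ?addr0 // => j ji.
by rewrite linearZ /= coord_basis_delta eq_sym (negPf ji) mulr0.
Qed.

Lemma counit_dual_reg : eps x = n%:R.
Proof.
rewrite dual_reg_form; last by lin.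
rewrite -[RHS](ltr_id H); refine (@eq_ltr K H _ _ _) => h.
by rewrite /hit (sw_counitl h (@lin_id _ H)).
Qed.

(** The elements c_ik = [cl i e_k] are the matrix coefficients of H as a comodule over itself and x
    is their diagonal sum, so its coproduct is the sum of all c_ik (x) c_ki, which is symmetric. *)
Lemma dual_reg_cocomm (W : vectType K) (B : H -> H -> W) :
    (forall b, lin (B^~ b)) -> (forall a, lin (B a)) ->
  sw B x = sw (fun a b => B b a) x.
Proof.
suff E (C : H -> H -> W) : (forall b, lin (C^~ b)) -> (forall a, lin (C a)) ->
    sw C x = \sum_(k < n) \sum_(i < n) C (cl i e`_k) (cl k e`_i).
  by move=> Bl Br; rewrite !E // exchange_big.
move=> Cl Cr.
have coordE (k : 'I_n) (F : 'I_n -> W) : \sum_(i < n) (coord e k e`_i : K) *: F i = F k.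
  rewrite (bigD1 k) //= coord_basis_delta eqxx scale1r big1 ?addr0 // => i ik.
  by rewrite coord_basis_delta eq_sym (negPf ik) scale0r.
have swl : lin (sw C) by lin.
rewrite /x (lin_sumE swl); apply: eq_bigr => k _.
transitivity (sw (fun a b => sw (fun c d => (coord e k b : K) *: C c d) a) e`_k).
  rewrite -[LHS](coordE k (fun i => sw C (cl i e`_k))).
  apply: eq_bigr => i _.
  by rewrite (sw_lin _ _ (@lin_scaler _ _ _ _ _ (@lin_id _ _))).
rewrite -(swA (T := fun c d b => (coord e k b : K) *: C c d)); [|by lin..].
apply: eq_bigr => i _; rewrite /sw.
exact: (coordE k (fun j => C (cl i e`_k) (cl j e`_i))).
Qed.

(** Inserting h_(2) S (h_(3)) turns p (y_(1) h) y_(2) into [hit p] (y h_(1)) S (h_(2)). Cyclicity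
    then lets right multiplication by S (h_(2)) act first, before that by h_(1). *)
Lemma dual_reg_mul p h : lin p ->
  p (x * h) = ltr (fun y : H => hit p (y * sw (fun a b => S b * a) h)).
Proof.
move=> pl; have hl := hit_lin pl.
rewrite (dual_reg_form (p := fun z => p (z * h))); last by lin.
transitivity (ltr (fun y : H => sw (fun a b => hit p (y * a) * S b) h)).
  refine (@eq_ltr K H _ _ _) => y.
  transitivity (sw (fun c d => sw (fun a b =>
      sw (fun a1 a2 => (p (c * a1) : K) *: (d * a2 * S b)) a) h) y); last first.
    rewrite sw_exch; apply: eq_sw => a b; rewrite /hit swM; [|by lin..].
    rewrite (sw_lin _ _ (G := fun z => z * S b)); last by lin.
    apply: eq_sw => c d; rewrite (sw_lin _ _ (G := fun z => z * S b)); last by lin.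
    by apply: eq_sw => a1 a2; rewrite scalerAl.
  apply: eq_sw => c d.
  rewrite -(swA (T := fun a1 a2 b => (p (c * a1) : K) *: (d * a2 * S b))); [|by lin..].
  rewrite -(sw_counitr h (G := fun z => (p (c * z) : K) *: d)); last by lin.
  apply: eq_sw => a1 b; rewrite -[d in LHS]mulr1.
  rewrite -(sw_antipoder b (G := fun z => (p (c * a1) : K) *: (d * z))); last by lin.
  by apply: eq_sw => u v; rewrite mulrA.
transitivity (sw (fun a b => ltr (fun y : H => hit p (y * (S b * a))) : K^o) h).
  rewrite [LHS]ltr_sum; apply: eq_bigr => i _.
  have Fl : lin (fun y => hit p (y * cl i h)) by lin.
  have Gl : lin (fun y => y * S e`_i) by lin.
  rewrite (ltr_comm Gl Fl); refine (@eq_ltr K H _ _ _) => y /=.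
  by rewrite mulrA.
transitivity (ltr (fun y : H => sw (fun a b => hit p (y * (S b * a))) h)).
  by rewrite [RHS]ltr_sum.
refine (@eq_ltr K H _ _ _) => y.
by rewrite [RHS](sw_lin _ _ (G := fun z => hit p (y * z))); last lin.
Qed.

(** Take h = x in [dual_reg_mul]: by cocommutativity S (x_(2)) x_(1) = S (x_(1)) x_(2) = eps (x) 1 =
    (dim H) 1. *)
Lemma dual_reg_idem : x * x = n%:R *: x.
Proof.
apply: form_ext => p pl; rewrite dual_reg_mul //.
rewrite (dual_reg_cocomm (B := fun a b => S b * a)); [|by lin..].
rewrite (sw_antipodel x (@lin_id _ H)) counit_dual_reg (linZ pl) dual_reg_form //.
rewrite -[RHS]/(n%:R * ltr (hit p)) -ltrZ.
refine (@eq_ltr K H _ _ _) => y.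
by rewrite -scalerAr mulr1 (linZ (hit_lin pl)).
Qed.

(** S^2 is a coalgebra map, so replacing p by p o S^2 conjugates [hit p] by S^2 and leaves its trace
    unchanged. *)
Lemma dual_reg_SS (Si : H -> H) : cancel S Si -> cancel Si S -> S (S x) = x.
Proof.
move=> SK SiK; apply: form_ext => p pl.
have Sil := Si_lin SK SiK; have hl := hit_lin pl.
rewrite (dual_reg_form (p := fun z => p (S (S z)))) ?(dual_reg_form pl); last by lin.
transitivity (ltr ((fun y => Si (Si (hit p y))) \o (fun y => S (S y)))).
  refine (@eq_ltr K H _ _ _) => y /=.
  rewrite /hit !sw_antipode; [|by lin..].
  rewrite !(sw_lin _ _ Sil); apply: eq_sw => a b.
  by rewrite !(linZ Sil) !SK.
have Fl : lin (fun y => Si (Si (hit p y))) by lin.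
have Gl : lin (fun y => S (S y)) by lin.
by rewrite (ltr_comm Fl Gl); refine (@eq_ltr K H _ _ _) => y /=; rewrite !SiK.
Qed.

(** By [right_int_int], [hit f] is the rank-one map y |-> f (y) 1. *)
Lemma right_int_dual_reg (Si : H -> H) : cancel S Si -> cancel Si S -> right_int Si x = right_int Si 1.
Proof.
move=> SK SiK; have fl := right_int_lin SK SiK.
rewrite (dual_reg_form fl) -(ltr_rank1 1 fl); refine (@eq_ltr K H _ _ _) => y.
exact: right_int_int.
Qed.

Lemma dual_reg_int h : (forall a, S (S a) = a) -> x * h = (eps h : K) *: x.
Proof.
move=> SS; apply: form_ext => p pl; have hl := hit_lin pl; rewrite dual_reg_mul //.
have -> : sw (fun a b => S b * a) h = (eps h : K) *: 1.
  rewrite -[X in _ *: X](antipode1 H) -(sw_antipodel h (G := S)); last by lin.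
  by apply: eq_sw => a b; rewrite antipodeM SS.
rewrite (linZ pl) dual_reg_form // -[RHS]/((eps h : K) * ltr (hit p)) -ltrZ.
by refine (@eq_ltr K H _ _ _) => y; rewrite -scalerAr mulr1 (linZ hl).
Qed.
End RegularElement.

(** * The theorem of Larson and Radford *)

Section Involutory.
Variables (K : closedFieldType) (H : hopfAlgType K).
Local Notation n := (\dim {:H}).
Local Notation eps := (counit : H -> K^o).
Local Notation S := (antipode : H -> H).
Hypotheses (charK : [pchar K] =i pred0) (ssH : semisimple_algebra H).

Lemma int_inj0 : injective (fun z : int => z%:~R : K).
Proof.
move=> u v /eqP; rewrite -subr_eq0 -rmorphB /= => uv.
apply/eqP; rewrite -subr_eq0; move: uv.
have natK m : (m%:R == 0 :> K) = (m == 0)%N by apply: (pcharf0P K).1.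
by case: (u - v) => m; rewrite ?NegzE ?rmorphN ?oppr_eq0 /= natK.
Qed.

Lemma antipode_involutive a : S (S a) = a.
Proof.
have [Lint eL] := hopf_integralP ssH; set L := hopf_integral H in Lint eL.
have Sinj := antipode_inj Lint ssH eL.
have [Si SK SiK] : exists2 Si : H -> H, cancel S Si & cancel Si S.
  have k0 : lker (antipode : 'End(H)) == 0%VS by apply/lker0P.
  by exists (antipode : 'End(H))^-1%VF; [apply: lker0_lfunK | apply: lker0_lfunVK].
have Sil := Si_lin SK SiK.
have f1 := right_int1_neq0 charK ssH SK SiK Lint eL.
have S4 b : S (S (S (S b))) = b.
  have := SSSS_dist_glike SK SiK Lint b.
  by rewrite (right_int1_glike SK SiK Lint eL f1) mulr1 mul1r.
pose R b := Si (Si b).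
have Rl : lin R by rewrite /R; lin.
have RR b : R (R b) = b by rewrite /R -{1}(S4 b) !SK.
have n0 : n%:R != 0 :> K.
  rewrite ((pcharf0P K).1 charK) -lt0n lt0n dimv_eq0; apply/eqP => H0.
  by have := memvf (1 : H); rewrite H0 memv0 oner_eq0.
(* By [dual_reg_idem] and [dual_reg_SS] this is an idempotent fixed by R; it is not yet known to be
   the integral. *)
pose e := (n%:R)^-1 *: dual_reg H.
have ee : e * e = e.
  by rewrite /e -scalerAl -scalerAr dual_reg_idem !scalerA -mulrA mulVf // mulr1.
have Re : R e = e.
  by rewrite /R /e !(linZ Sil) -{1}(dual_reg_SS SK SiK) !SK.
have RM b c : R (b * c) = R b * R c by rewrite /R !(SiM SK SiK).
(* The square of y |-> R (e y) is the idempotent map y |-> e y, so its eigenvalues are among 0, 1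
   and -1. *)
have [z Ez] : exists z : int, ltr (fun y => R (e * y)) = 1 * z%:~R.
  apply: ltr_signed; first by lin.
  move=> b v v0 Rv; rewrite !inE.
  have bv : e * v = b ^+ 2 *: v.
    have <- : R (e * R (e * v)) = e * v by rewrite RM RR Re mulrA ee.
    by rewrite Rv -scalerAr (linZ Rl) Rv scalerA.
  have : e * (e * v) = e * v by rewrite mulrA ee.
  rewrite bv -scalerAr bv scalerA => /eqP; rewrite -subr_eq0 -scalerBl scaler_eq0.
  rewrite (negPf v0) orbF -[X in _ - X]mulr1 -mulrBr mulf_eq0 expf_eq0 /=.
  case/orP => [->//|]; rewrite subr_eq0 sqrf_eq1.
  by case/orP => ->; rewrite ?orbT.
have fR : right_int Si 1 = ltr R by refine (@eq_ltr K H _ _ _) => y; rewrite mul1r.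
have trR : ltr R = n%:R * z%:~R.
  rewrite -fR -right_int_dual_reg // -[z%:~R]mul1r -Ez -ltrZ; refine (@eq_ltr K H _ _ _) => y.
  by rewrite -(linZ Rl) /e scalerAl scalerA divff // scale1r.
(* The projections onto the eigenspaces of R for -1 and 1; m and m' will be their ranks. *)
pose P b := (2%:R)^-1 *: (b - R b); pose Q b := (2%:R)^-1 *: (b + R b).
have two0 : 2%:R != 0 :> K by rewrite ((pcharf0P K).1 charK).
have Pl : lin P by rewrite /P; lin.
have Ql : lin Q by rewrite /Q; lin.
have PP b : P (P b) = P b.
  rewrite {1}/P /P (linZ Rl) (linB Rl) RR -scalerBr; congr (_ *: _).
  by rewrite opprB -mulr2n -scaler_nat scalerA mulVf // scale1r.
have QQ b : Q (Q b) = Q b.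
  rewrite {1}/Q /Q (linZ Rl) (linD Rl) RR -scalerDr; congr (_ *: _).
  by rewrite [R b + b]addrC -mulr2n -scaler_nat scalerA mulVf // scale1r.
have trP : ltr P = 2%:R^-1 * (n%:R - n%:R * z%:~R).
  rewrite [LHS]ltrZ -trR -[in RHS]ltr_id /ltr -sumrB; congr (_ * _).
  by apply: eq_bigr => i _; rewrite linearB.
have trQ : ltr Q = 2%:R^-1 * (n%:R + n%:R * z%:~R).
  rewrite [LHS]ltrZ -trR -[in RHS]ltr_id /ltr -big_split; congr (_ * _).
  by apply: eq_bigr => i _; rewrite linearD.
have [m [_ Em] m0] := ltr_idem Pl PP.
have [m' [_ Em'] m'0] := ltr_idem Ql QQ.
have {}m'0 : (0 < m')%N.
  apply: (m'0 1); rewrite /Q /R (Si1 SK) (Si1 SK) -mulr2n -scaler_nat scalerA mulVf // scale1r.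
  by apply/eqP; apply: oner_neq0.
have Dn : n = (m + m')%N.
  apply: (natr_inj0 charK); rewrite natrD -Em -Em' trP trQ -mulrDr addrCA subrK.
  by rewrite -mulr2n -[X in _ * X]mulr_natl mulrA mulVf // mul1r.
have Dz : (m'%:Z - m%:Z = n%:Z * z)%R.
  apply: int_inj0; rewrite rmorphB rmorphM /= -[m'%:~R]/(m'%:R) -[m%:~R]/(m%:R) -Em -Em'.
  rewrite trP trQ -mulrBr opprB [_ - n%:R]addrC addrACA subrr add0r.
  by rewrite -mulr2n -[X in _ * X]mulr_natl mulrA mulVf // mul1r.
have z0 : z != 0 by apply/eqP => z0; apply: f1; rewrite fR trR z0 mulr0.
(* Here m + m' = dim H, m' - m is a nonzero multiple of dim H, and m' > 0 because R fixes 1: this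
   leaves m = 0. *)
have mz : m = 0%N by rewrite Dn in Dz; nia.
have : P a = 0.
  by apply/eqP/negPn/negP => /eqP/m0; rewrite mz.
move/eqP; rewrite /P scaler_eq0 invr_eq0 (negPf two0) subr_eq0 /= => /eqP Ra.
by rewrite {1}Ra /R !SiK.
Qed.

(** Both x and Lambda being integrals, x Lambda is at once eps (Lambda) x and eps (x) Lambda. *)
Lemma dual_reg_integral : dual_reg H = n%:R *: hopf_integral H.
Proof.
have [Lint eL] := hopf_integralP ssH.
have := dual_reg_int (hopf_integral H) antipode_involutive.
by rewrite eL scale1r (Lint _).1 counit_dual_reg.
Qed.
End Involutory.

(** * The trace of powers of the canonical tensor *)

Section TensorTrace.
Variables (K : fieldType) (A B : falgType K) (M : fdmodule A) (N : fdmodule B).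

Lemma lftrace_tens (a : A) (b : B) :
  lftrace (mact (tensor_module M N) (a *t b)) = lftrace (mact M a) * lftrace (mact N b).
Proof.
rewrite -[mact (tensor_module M N) _]/(tensor_act M N (a *t b)) !lftrace_ltr.
pose u (ij : 'I_(\dim {:M}) * 'I_(\dim {:N})) :=
  (vbasis {:M})`_ij.1 *t (vbasis {:N})`_ij.2.
pose p (ij : 'I_(\dim {:M}) * 'I_(\dim {:N})) : tensor M N -> K^o :=
  tpair (linfun (coord (vbasis {:M}) ij.1 : M -> K^o))
        (linfun (coord (vbasis {:N}) ij.2 : N -> K^o)).
rewrite (ltr_dual (u := u) (p := p)).
- rewrite {1}/ltr mulr_suml -(pair_bigA _ (fun i j => p (i, j) (tensor_act M N (a *t b) (u (i, j))))).
  apply: eq_bigr => i _; rewrite /ltr mulr_sumr; apply: eq_bigr => j _.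
  by rewrite /p /u /= tensor_actE tpairE !lfunE.
- by move=> ij; rewrite /p; lin.
- by lin.
elim/tensor_ind => [v w|s t {1}-> {1}->]; last first.
  by rewrite -big_split; apply: eq_bigr => ij _; rewrite /p linearD scalerDl.
rewrite {1}[v](coord_vbasis (memvf v)) {1}[w](coord_vbasis (memvf w)).
rewrite tens_suml -(pair_bigA _ (fun i j => (p (i, j) (v *t w) : K) *: u (i, j))).
apply: eq_bigr => i _; rewrite tens_sumr; apply: eq_bigr => j _.
by rewrite tensZl tensZr scalerA /p tpairE !lfunE.
Qed.
End TensorTrace.

Lemma regular_actE (K : fieldType) (A : falgType K) (a x : A) :
  mact (regular_module A) a x = a * x.
Proof. by rewrite !lfunE. Qed.

(** * Powers of the canonical tensor as convolution powers of the identity *)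

Section CanonicalTensor.
Variables (K : fieldType) (H : hopfAlgType K).
Local Notation e := (vbasis {:H}).

Lemma dual_mulE (p q : hopf_dual H) (h : H) :
  ((p * q : hopf_dual H) : 'Hom(H, K^o)) h
  = sw (fun a b => ((p : 'Hom(H, K^o)) a : K) *: (q : 'Hom(H, K^o)) b) h.
Proof.
rewrite -[LHS]/((tpair p q \o coprod)%VF h) comp_lfunE coprodE linear_sum.
by apply: eq_bigr => i _; rewrite /= tpairE.
Qed.

(** Left multiplication by p is the transpose of [hit p], which shows in the dual family of
    coordinate forms and evaluations at the basis. *)
Lemma lftrace_dual (p : hopf_dual H) :
  lftrace (mact (regular_module (hopf_dual H)) p) = (p : 'Hom(H, K^o)) (dual_reg H).
Proof.
rewrite lftrace_ltr (dual_reg_form (p := (p : 'Hom(H, K^o)))); last by lin.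
pose u (i : 'I_(\dim {:H})) : hopf_dual H := linfun (coord e i : H -> K^o).
pose v (i : 'I_(\dim {:H})) (q : hopf_dual H) : K^o := (q : 'Hom(H, K^o)) e`_i.
have vl i : lin (v i) by move=> a x y; rewrite /v add_lfunE scale_lfunE.
rewrite (ltr_dual (u := u) (p := v)) //.
- apply: eq_bigr => i _; rewrite /v regular_actE dual_mulE.
  rewrite /hit /sw linear_sum; apply: eq_bigr => j _.
  by rewrite linearZ /= /u linfunE //; lin.
- by lin.
move=> q; apply/lfunP => h; rewrite sum_lfunE.
rewrite [in LHS](coord_vbasis (memvf h)) linear_sum; apply: eq_bigr => i _.
by rewrite scale_lfunE linearZ /u lfunE /= [LHS]mulrC.
Qed.

(** Evaluation at y under the identification of H (x) H^* with End (H), where products become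
    convolution and the canonical tensor becomes the identity. *)
Definition teval (y : H) (s : tensor H (hopf_dual H)) : H :=
  tlift (fun (a : H) (p : hopf_dual H) => ((p : 'Hom(H, K^o)) y : K) *: a) s.

Lemma tevalE y a (p : hopf_dual H) : teval y (a *t p) = ((p : 'Hom(H, K^o)) y : K) *: a.
Proof.
rewrite /teval tliftE // => [q|b] c u v; first by rewrite scalerDr !scalerA mulrC.
by rewrite add_lfunE scale_lfunE scalerDl scalerA.
Qed.

Lemma teval_lin y : lin (teval y).
Proof. by rewrite /teval; lin. Qed.

Lemma teval_point_lin s : lin (teval^~ s).
Proof.
elim/tensor_ind: s => [a p|s t sl tl] c u v; rewrite ?tevalE.
  by rewrite linearP scalerDl scalerA.
by rewrite !(linD (teval_lin _)) sl tl scalerDr addrACA.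
Qed.

Lemma teval_canonicalM y s :
  teval y (canonical_tensor H * s) = sw (fun a b => a * teval b s) y.
Proof.
have yl := teval_lin y; have pl := teval_point_lin.
elim/tensor_ind: s => [a p|s t IHs IHt]; last first.
  rewrite mulrDr (linD yl) IHs IHt -big_split; apply: eq_bigr => i _ /=.
  by rewrite (linD (teval_lin _)) mulrDr.
rewrite /canonical_tensor /canonical_tensor_of mulr_suml (lin_sumE yl).
transitivity (\sum_(k < \dim {:H}) sw (W := H) (fun c d =>
    (coord e k c * (p : 'Hom(H, K^o)) d) *: (e`_k * a)) y).
  apply: eq_bigr => k _; rewrite tensM tevalE dual_mulE.
  rewrite (sw_lin _ _ (G := fun z : K^o => (z : K) *: (e`_k * a))); last by lin.
  by apply: eq_sw => c d; rewrite linfunE //; lin.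
rewrite [LHS]exchange_big; apply: eq_bigr => i _.
rewrite tevalE -scalerAr scalerAl.
transitivity (\sum_(k < \dim {:H}) (coord e k (cl i y) : K) *:
    (((p : 'Hom(H, K^o)) e`_i : K) *: e`_k * a)); last first.
  apply: (lin_coordE (X := fun z => ((p : 'Hom(H, K^o)) e`_i : K) *: z * a)); lin.
by apply: eq_bigr => k _; rewrite -scalerAl scalerA.
Qed.

Lemma sweedler_powS (y : H) k :
  sweedler_pow y k.+2 = sw (fun a b => a * sweedler_pow b k.+1) y.
Proof.
rewrite /= comp_lfunE coprodE !linear_sum; apply: eq_bigr => i _ /=.
rewrite tmapE id_lfunE tliftE // => [s|a] c u v.
  by rewrite mulrDl -scalerAl.
by rewrite linearP mulrDr -scalerAr.
Qed.

Lemma teval_canonical_pow (y : H) k :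
  teval y (canonical_tensor H ^+ k.+1) = sweedler_pow y k.+1.
Proof.
elim: k y => [|k IH] y.
  rewrite /= !id_lfunE expr1 /canonical_tensor (lin_sumE (teval_lin y)).
  rewrite [RHS](coord_vbasis (memvf y)); apply: eq_bigr => i _.
  by rewrite tevalE linfunE //; lin.
by rewrite exprS teval_canonicalM sweedler_powS; apply: eq_sw => a b; rewrite IH.
Qed.

Lemma lftrace_teval (V : fdmodule H) (s : tensor H (hopf_dual H)) :
  lftrace (mact (tensor_module V (regular_module (hopf_dual H))) s)
    = mchar V (teval (dual_reg H) s).
Proof.
have trl (W : vectType K) (F G : 'End(W)) : lftrace (F + G) = lftrace F + lftrace G.
  rewrite !lftrace_ltr /ltr -big_split; apply: eq_bigr => i _.
  by rewrite add_lfunE linearD.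
elim/tensor_ind: s => [a p|s t IHs IHt]; last first.
  by rewrite (linD (teval_lin _)) /mchar !linearD !trl IHs IHt.
rewrite lftrace_tens lftrace_dual tevalE /mchar linearZ /= !lftrace_ltr mulrC.
by rewrite -ltrZ; apply: eq_ltr => v; rewrite scale_lfunE.
Qed.
End CanonicalTensor.

Theorem proposition3p2 (K : closedFieldType) (charK : [pchar K] =i pred0)
    (H : hopfAlgType K) (ssH : semisimple_algebra H)
    (V : fdmodule H) (m : nat) (m_gt0 : (0 < m)%N) :
  fs_indicator m (mchar V)
    = (\dim {:H})%:R^-1
      * lftrace (mact (tensor_module V (regular_module (hopf_dual H)))
                      (canonical_tensor H ^+ m)).
Proof.
case: m m_gt0 => // k _.
(* The trace of t^m is chi (x^[m]) with x = (dim H) Lambda, and y |-> y^[m] is linear, being y |->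
   [teval y] (t^m). *)
rewrite lftrace_teval (dual_reg_integral charK ssH).
rewrite (linZ (@teval_point_lin K H _)) teval_canonical_pow /fs_indicator /mchar.
have n0 : (\dim {:H})%:R != 0 :> K.
  rewrite ((pcharf0P K).1 charK) -lt0n lt0n dimv_eq0; apply/eqP => H0.
  by have := memvf (1 : H); rewrite H0 memv0 oner_eq0.
set a := sweedler_pow _ _; rewrite linearZ /= !lftrace_ltr -ltrZ.
by apply: eq_ltr => v; rewrite scale_lfunE scalerA mulVf // scale1r.
Qed.
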